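(* Let $\mathcal{G}$ be a non-discrete finite simplicial graph with at least $3$ vertices, and let $C(\mathcal{G})$ be the right-angled Coxeter group associated to $\mathcal{G}$. Then all infinite-index convex-cocompact subgroups of $C(\mathcal{G})$ are $\mathcal{A}$-separable and $\mathcal{S}$-separable if and only if the complement graph $\mathcal{G}^c$ is connected.
   Context: A graph is discrete if it has no edges. $\mathcal{G}^c$ is the graph on the same vertex set as $\mathcal{G}$ in which two distinct vertices are adjacent iff they are not adjacent in $\mathcal{G}$. The right-angled Coxeter group associated to a simplicial graph $\mathcal{G}$ with vertex set $I$ is $C(\mathcal{G})=\langle s_i,\ i\in I \mid s_i^2=1 \text{ for } i\in I,\ [s_i,s_j]=1 \text{ for } \{i,j\}\in E(\mathcal{G})\rangle$. The Davis--Moussong complex $DM(\mathcal{G})$ is the cube complex with vertex set $C(\mathcal{G})$, with an edge labelled $s$ joining $g$ and $gs$ for each $g\in C(\mathcal{G})$ and each generator $s$, and, for each $g$ and each set of distinct pairwise commuting generators $s_{i_1},\dots,s_{i_n}$, one $n$-cube with vertex set $\{g\prod_{j\in P}s_{i_j} : P\subset\{1,\dots,n\}\}$ (a cube is determined by its vertex set). $C(\mathcal{G})$ acts on it by left multiplication. A subcomplex $Y$ of a cube complex $X$ is convex if every geodesic of the 1-skeleton $X^{(1)}$ (edge-path metric) with endpoints in $Y$ is contained in $Y$. A subgroup $H$ of $C(\mathcal{G})$ is convex-cocompact if there is a non-empty convex subcomplex $Y\subset DM(\mathcal{G})$ that is invariant under $H$ and on which $H$ acts cocompactly. For a class $\mathcal{C}$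 of groups, a subgroup $H$ of a finitely generated group $G$ is $\mathcal{C}$-separable (in $G$) if for any finite set $\{\gamma_1,\dots,\gamma_m\}\subset G\setminus H$ there is a surjective homomorphism $f$ from $G$ onto a group in $\mathcal{C}$ such that $f(\gamma_i)\notin f(H)$ for all $i$. $\mathcal{A}$ denotes the class of finite alternating groups and $\mathcal{S}$ the class of finite symmetric groups.
   Formalization: The graph is additionally assumed not to be complete: for a complete graph on at least 3 vertices the group is finite, so the separability side holds vacuously while the complement graph is disconnected, and the stated equivalence fails. *)

(* Defs.v *)
From HB Require Import structures.
From mathcomp Require Import all_boot all_fingroup alt.
From mathcomp Require Import generic_quotient.
From mathcomp Require Import mathcomp_extra boolp classical_sets cardinality.

Set Implicit Arguments.
Unset Strict Implicit.
Unset Printing Implicit Defensive.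

Local Open Scope group_scope.
Local Open Scope classical_set_scope.
Local Open Scope quotient_scope.

Section Presentation.
Variable I : choiceType.

(* The letter (i, true) stands for the generator i, (i, false) for its inverse. *)
Definition word := seq (I * bool).

Definition winv (w : word) : word := rev [seq (l.1, ~~ l.2) | l <- w].

Variable R : set word.

Inductive pres_eq : word -> word -> Prop :=
| pres_refl u : pres_eq u u
| pres_sym u v : pres_eq u v -> pres_eq v u
| pres_trans u v w : pres_eq u v -> pres_eq v w -> pres_eq u w
| pres_cat u u' v v' :
    pres_eq u u' -> pres_eq v v' -> pres_eq (u ++ v) (u' ++ v')
| pres_cancel i b : pres_eq [:: (i, b); (i, ~~ b)] [::]
| pres_relator r : R r -> pres_eq r [::].

Definition pres_eqb : rel word := fun u v => `[< pres_eq u v >].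

Lemma pres_eqb_refl : reflexive pres_eqb.
Proof. by move=> u; apply/asboolP; exact: pres_refl. Qed.

Lemma pres_eqb_sym : symmetric pres_eqb.
Proof. by move=> u v; apply/asboolP/asboolP => /pres_sym. Qed.

Lemma pres_eqb_trans : transitive pres_eqb.
Proof.
by move=> v u w /asboolP uv /asboolP vw; apply/asboolP; exact: pres_trans vw.
Qed.

Canonical pres_equiv :=
  EquivRel pres_eqb pres_eqb_refl pres_eqb_sym pres_eqb_trans.

Definition presented := {eq_quot pres_equiv}.

HB.instance Definition _ := Choice.on presented.


Lemma pres_piP (u v : word) : \pi_presented u = \pi_presented v <-> pres_eq u v.
Proof.
split=> [/eqmodP/asboolP//|uv].
by apply/eqmodP/asboolP.
Qed.

Lemma pres_repr (u : word) : pres_eq (repr (\pi_presented u)) u.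
Proof. by apply/pres_piP; rewrite reprK. Qed.

Lemma winv_cat u v : winv (u ++ v) = winv v ++ winv u.
Proof. by rewrite /winv map_cat rev_cat. Qed.

Lemma winvK : involutive winv.
Proof.
move=> w; rewrite /winv map_rev revK -map_comp map_id_in //.
by move=> [i b] _ /=; rewrite negbK.
Qed.

Lemma pres_winvl w : pres_eq (winv w ++ w) [::].
Proof.
elim: w => [|[i b] w IH]; first exact: pres_refl.
rewrite -cat1s winv_cat -catA (catA _ _ w).
apply: (pres_trans _ IH); apply: pres_cat; first exact: pres_refl.
rewrite -[X in pres_eq _ X]cat0s; apply: pres_cat; last exact: pres_refl.
by have := pres_cancel i (~~ b); rewrite negbK.
Qed.

Lemma pres_winvr w : pres_eq (w ++ winv w) [::].
Proof. by have := pres_winvl (winv w); rewrite winvK. Qed.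

Lemma pres_winv u v : pres_eq u v -> pres_eq (winv u) (winv v).
Proof.
move=> uv; rewrite -[winv u]cats0.
apply: (@pres_trans _ (winv u ++ (v ++ winv v))).
  apply: pres_cat; first exact: pres_refl.
  by apply: pres_sym; exact: pres_winvr.
rewrite catA -[X in pres_eq _ X]cat0s; apply: pres_cat; last exact: pres_refl.
apply: (@pres_trans _ (winv u ++ u)); last exact: pres_winvl.
by apply: pres_cat; [exact: pres_refl | exact: pres_sym].
Qed.

Definition pres_mul (x y : presented) : presented := \pi_presented (repr x ++ repr y).
Definition pres_one : presented := \pi_presented [::].
Definition pres_inv (x : presented) : presented := \pi_presented (winv (repr x)).

Lemma pres_mul_pi u v : pres_mul (\pi_presented u) (\pi_presented v) = \pi_presented (u ++ v).
Proof. by apply/pres_piP; apply: pres_cat; exact: pres_repr. Qed.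

Lemma pres_inv_pi u : pres_inv (\pi_presented u) = \pi_presented (winv u).
Proof. by apply/pres_piP; apply: pres_winv; exact: pres_repr. Qed.

Lemma pres_mulA : associative pres_mul.
Proof.
move=> x y z; rewrite -[x]reprK -[y]reprK -[z]reprK.
by rewrite (pres_mul_pi (repr y)) (pres_mul_pi (repr x)) (pres_mul_pi (repr x)) pres_mul_pi catA.
Qed.

Lemma pres_mul1 : left_id pres_one pres_mul.
Proof. by move=> x; rewrite -[x]reprK pres_mul_pi cat0s. Qed.

Lemma pres_mulr1 : right_id pres_one pres_mul.
Proof. by move=> x; rewrite -[x]reprK pres_mul_pi cats0. Qed.

Lemma pres_mulV : left_inverse pres_one pres_inv pres_mul.
Proof.
move=> x; rewrite -[x]reprK pres_inv_pi pres_mul_pi.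
by apply/pres_piP; exact: pres_winvl.
Qed.

Lemma pres_mulrV : right_inverse pres_one pres_inv pres_mul.
Proof.
move=> x; rewrite -[x]reprK pres_inv_pi pres_mul_pi.
by apply/pres_piP; exact: pres_winvr.
Qed.

HB.instance Definition _ := isGroup.Build presented
  pres_mulA pres_mul1 pres_mulr1 pres_mulV pres_mulrV.

Definition pres_gen (i : I) : presented := \pi_presented [:: (i, true)].

End Presentation.

Section Graphs.
Variable I : finType.
Implicit Type e : rel I.

Definition simple_graph e := symmetric e /\ irreflexive e.

Definition discrete_graph e := forall i j, ~~ e i j.

(* The group of a complete graph is finite, so it has no subgroup of infinite
   index, whereas the complement of a complete graph is discrete. *)
Definition complete_graph e := forall i j, i != j -> e i j.

Definition graph_compl e : rel I := [rel i j | (i != j) && ~~ e i j].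

Definition connected_graph e := 0 < #|I| /\ forall i j, connect e i j.

End Graphs.

Inductive racg_relator (I : finType) (e : rel I) : set (word I) :=
| racg_square i : racg_relator e [:: (i, true); (i, true)]
| racg_commutator i j : e i j ->
    racg_relator e [:: (i, false); (j, false); (i, true); (j, true)].

Definition racg (I : finType) (e : rel I) : groupType :=
  presented (racg_relator e).

Definition racg_gen (I : finType) (e : rel I) (i : I) : racg e :=
  pres_gen (racg_relator e) i.

(* A cube complex all of whose cubes are determined by their vertex sets is
   encoded by the collection of these vertex sets; the vertices themselves
   appear as singletons. *)
Section CubeComplex.
Variable V : Type.
Implicit Types X Y : set (set V).

Definition subcomplex X Y :=
  Y `<=` X /\ forall c d, Y c -> X d -> d `<=` c -> Y d.

Definition skel_adj X : rel V :=
  fun u v => `[< u <> v /\ X [set u; v] >].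

(* The edge path with successive vertices u :: p is a geodesic of X^(1). *)
Definition geodesic X (u : V) (p : seq V) :=
  path (skel_adj X) u p /\
  forall q, path (skel_adj X) u q -> last u q = last u p -> size p <= size q.

(* [path (skel_adj Y) u p] says that all the edges of the path lie in Y, hence
   so do its vertices, Y being a subcomplex. *)
Definition convex_subcomplex X Y :=
  subcomplex X Y /\
  forall u p, Y [set u] -> Y [set last u p] ->
    geodesic X u p -> path (skel_adj Y) u p.

End CubeComplex.

(* The order of the factors in the product over Q is irrelevant, since the
   generators indexed by P commute. *)
Definition DM (I : finType) (e : rel I) : set (set (racg e)) :=
  [set c | exists (g : racg e) (P : {set I}),
    {in P &, forall i j, commute (racg_gen e i) (racg_gen e j)} /\
    c = [set g * \prod_(i in Q) racg_gen e i | Q in [set Q : {set I} | Q \subset P]]].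

Arguments DM {I} e _.

Definition is_subgroup (G : groupType) (H : set G) := group_closed [in H].

Definition ltranslate (G : groupType) (g : G) (A : set G) : set G :=
  [set g * x | x in A].

Definition infinite_index (G : groupType) (H : set G) :=
  infinite_set [set ltranslate g H | g in [set: G]].

Definition invariant_under (G : groupType) (H : set G) (Y : set (set G)) :=
  forall h c, H h -> Y c -> Y (ltranslate h c).

(* Compactness of the quotient of Y by H amounts to Y having finitely many
   H-orbits of cubes. *)
Definition cocompact_on (G : groupType) (H : set G) (Y : set (set G)) :=
  exists K : set (set G), [/\ finite_set K, K `<=` Y &
    forall c, Y c -> exists h k, [/\ H h, K k & c = ltranslate h k]].

Definition convex_cocompact (I : finType) (e : rel I) (H : set (racg e)) :=
  exists Y : set (set (racg e)),
    [/\ Y !=set0, convex_subcomplex (DM e) Y,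
        invariant_under H Y & cocompact_on H Y].

Definition group_class := groupType -> Prop.

Definition separable (C : group_class) (G : groupType) (H : set G) :=
  forall F : set G, finite_set F -> F `<=` ~` H ->
    exists (Q : groupType) (f : {multiplicative G -> Q}),
      [/\ C Q, range f = [set: Q] & forall x, F x -> ~ (f @` H) (f x)].

Definition isomorphic_groups (G K : groupType) :=
  exists f : {multiplicative G -> K}, bijective f.

Definition alternating_groups : group_class :=
  fun Q => exists n : nat, isomorphic_groups Q [subg 'Alt_('I_n)]%type.

Definition symmetric_groups : group_class :=
  fun Q => exists n : nat, isomorphic_groups Q {perm 'I_n}.

(* Main.v *)
(* Let W be the Coxeter group. Suppose the complement graph is connected, and let H
   act cocompactly on the convex subcomplex Y. Replacing the edges that leave Y by
   loops turns the vertex set of H\Y into a finite right W-set on which H fixes a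
   point. A loop labelled g that is not an edge of the Schreier graph of H can be
   opened up: g then exchanges an invariant set of such loops with a new copy of it.
   Doing this along words for the given elements makes each of them move the point
   fixed by H. Since H has infinite index there remains a loop to open; opening up
   new points along a walk in the complement graph that visits every vertex finally
   produces a point fixed by all generators but one, because no vertex is adjacent
   to all vertices of the walk. At this point one may attach, for a path s - t - u of
   the complement graph with s and u adjacent, a square for s and u with two long
   paths, alternating in (s, t) and (u, t), that issue from one of its corners along
   its two sides and have only this corner in common. Suitable powers of st and ut
   are then supported on these two paths, and their commutator is a 3-cycle; moving
   it around by the transitive action one obtains the alternating group. The
   parities of the generators are adjusted by doubling the W-set beforehand and by
   the lengths of the paths.
   If the complement graph is disconnected, W is a product of two commuting special
   subgroups, one of them infinite; in a large alternating quotient the image of one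
   factor is normal, hence everything, so that the other factor has central image.
   Hence the trivial subgroup is not separable. *)
Require Import Defs.
From HB Require Import structures.
From mathcomp Require Import all_boot all_fingroup alt zify.
From mathcomp Require Import boolp.

Set Implicit Arguments.
Unset Strict Implicit.
Unset Printing Implicit Defensive.

(** * Permutation groups containing the alternating group *)

Section ThreeCycles.
Local Open Scope group_scope.
Variable X : finType.
Implicit Types (a b c d x y z : X) (G : {group {perm X}}) (S : {set X}).

Definition cycle3 a b c : {perm X} := tperm a b * tperm a c.

Lemma cycle3J a b c (p : {perm X}) :
  cycle3 a b c ^ p = cycle3 (p a) (p b) (p c).
Proof. by rewrite /cycle3 conjMg !tpermJ. Qed.

Lemma cycle3E1 a b c : a != b -> b != c -> cycle3 a b c a = b.
Proof. by move=> ab bc; rewrite permM tpermL tpermD // eq_sym. Qed.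

Lemma cycle3E2 a b c : cycle3 a b c b = c.
Proof. by rewrite permM tpermR tpermL. Qed.

Lemma cycle3E3 a b c : a != c -> b != c -> cycle3 a b c c = a.
Proof. by move=> ac bc; rewrite permM (tpermD ac bc) tpermR. Qed.

Lemma cycle3E a b c x : x != a -> x != b -> x != c -> cycle3 a b c x = x.
Proof. by rewrite !(eq_sym x) permM => xa xb xc; rewrite !tpermD. Qed.

Lemma cycle3V a b c : (cycle3 a b c)^-1 = cycle3 a c b.
Proof. by rewrite /cycle3 invMg !tpermV. Qed.

Lemma cycle3_rot a b c : a != b -> b != c -> a != c -> cycle3 a b c = cycle3 b c a.
Proof.
move=> ab bc ac; rewrite /cycle3 (tpermC b a).
have -> : tperm b c = tperm a c ^ tperm a b.
  by rewrite tpermJ tpermL tpermD.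
by rewrite conjgE tpermV -!mulgA tperm2 mulg1.
Qed.

(** Every point other than [m] that [p] moves is fixed by [q], so [p ^ q] is [p] with [m] replaced
    by [q m] in its cycles; multiplying by [p^-1] leaves a 3-cycle. *)
Lemma commg_cycle3 (p q : {perm X}) m :
  (forall x, x != m -> p x = x \/ q x = x) -> p m != m -> q m != m ->
  [~ p, q] = cycle3 (p m) m (q m).
Proof.
move=> pq pm qm.
have pqm : p m != q m.
  apply/eqP => E; case: (pq _ pm) => [/perm_inj/eqP|]; first by rewrite (negPf pm).
  by rewrite E => /perm_inj/eqP; rewrite (negPf qm).
have qpm : q (p m) = p m by case: (pq _ pm) => // /perm_inj/eqP; rewrite (negPf pm).
have pqm' : p (q m) = q m by case: (pq _ qm) => // /perm_inj/eqP; rewrite (negPf qm).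
apply/permP => x; rewrite commgEl conjgE (permM p^-1) (permM q^-1) (permM p).
have [->|xpm] := eqVneq x (p m).
  rewrite permK cycle3E1 //; last by rewrite eq_sym.
  have : q (q^-1 m) = m by rewrite permKV.
  set y := q^-1 m => qy.
  have [E|ym] := eqVneq y m; first by move: qm; rewrite -{1}E qy eqxx.
  by case: (pq _ ym) => [->//|]; rewrite qy => E; rewrite E eqxx in ym.
have [->|xm] := eqVneq x m.
  rewrite cycle3E2.
  have : p (p^-1 m) = m by rewrite permKV.
  set y := p^-1 m => py.
  have [E|ym] := eqVneq y m; first by move: pm; rewrite -{1}E py eqxx.
  case: (pq _ ym) => E; first by rewrite py in E; rewrite -E eqxx in ym.
  by rewrite (canLR (permK q) (esym E)) py.
have [->|xqm] := eqVneq x (q m).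
  rewrite cycle3E3 // 1?eq_sym //.
  by rewrite (canLR (permK p) (esym pqm')) permK qpm.
rewrite cycle3E //.
case: (pq _ xm) => E.
  rewrite (canLR (permK p) (esym E)).
  set y := q^-1 x; have qy : q y = x by rewrite permKV.
  have [E'|ym] := eqVneq y m; first by rewrite -qy E' eqxx in xqm.
  case: (pq _ ym) => [->//|]; rewrite qy => E'.
  by rewrite -E' E {1}E'.
set y := p^-1 x; have py : p y = x by rewrite permKV.
have [E'|ym] := eqVneq y m; first by rewrite -py E' eqxx in xpm.
case: (pq _ ym) => E'; last by rewrite (canLR (permK q) (esym E')) py E.
by move: E'; rewrite py => E'; rewrite -E' (canLR (permK q) (esym E)) {1}E' py E.
Qed.

Definition has_cycles3 G S :=
  forall a b c, a \in S -> b \in S -> c \in S ->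
    a != b -> b != c -> a != c -> cycle3 a b c \in G.

Lemma cycle3_sym G a b c : cycle3 a b c \in G -> cycle3 a c b \in G.
Proof. by rewrite -cycle3V groupV. Qed.

Lemma exists_third S x y : 2 < #|S| -> exists z, [/\ z \in S, z != x & z != y].
Proof.
move=> S3; have : 0 < #|S :\: [set x; y]|.
  rewrite cardsD subn_gt0; apply: leq_ltn_trans S3.
  apply: leq_trans (subset_leq_card (subsetIr _ _)) _.
  by rewrite cards2; case: (x != y).
by case/card_gt0P => z; rewrite !inE negb_or => /andP[/andP[zx zy] zS]; exists z.
Qed.

(** Conjugation by 3-cycles on [S] carries the pair [x0], [y0] to any other pair, one entry being
    exchanged at a time. *)
Lemma has_cycles3_pair G S b x0 y0 : has_cycles3 G S -> b \notin S ->
  x0 \in S -> y0 \in S -> x0 != y0 -> cycle3 b x0 y0 \in G ->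
  has_cycles3 G (b |: S).
Proof.
move=> GS bS x0S y0S xy0 Gb.
have ne_b x : x \in S -> b != x by move=> xS; apply: contraNneq bS => ->.
have step x y z : x \in S -> y \in S -> z \in S -> x != y -> z != x -> z != y ->
    cycle3 b x y \in G -> cycle3 b y z \in G.
  move=> xS yS zS xy zx zy /groupJ-/(_ (cycle3 x y z)).
  rewrite cycle3J cycle3E2 cycle3E1 ?cycle3E ?ne_b // 1?eq_sym //.
  by apply; apply: GS => //; rewrite eq_sym.
have step' x y z : x \in S -> y \in S -> z \in S -> x != y -> z != x -> z != y ->
    cycle3 b x y \in G -> cycle3 b z x \in G.
  move=> xS yS zS xy zx zy /cycle3_sym H; apply: cycle3_sym.
  by apply: step H => //; rewrite eq_sym.
have all_b u v : u \in S -> v \in S -> u != v -> cycle3 b u v \in G.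
  move=> uS vS uv.
  have [ux|ux] := eqVneq u x0.
    have [->|vy] := eqVneq v y0; first by rewrite ux.
    by apply: cycle3_sym; rewrite ux; apply: step' Gb => //; rewrite -?ux eq_sym // eq_sym.
  have [uy|uy] := eqVneq u y0.
    have [->|vx] := eqVneq v x0; first by rewrite uy; exact: cycle3_sym.
    by rewrite uy; apply: step Gb => //; rewrite -uy eq_sym.
  have Gux : cycle3 b u x0 \in G by apply: step' Gb.
  have [->//|vx] := eqVneq v x0.
  by apply: cycle3_sym; apply: step' Gux => //; rewrite eq_sym.
move=> p q r; rewrite !inE => /predU1P[->|pS] /predU1P[->|qS] /predU1P[->|rS];
  rewrite ?eqxx // => pq qr pr.
- exact: all_b.
- by rewrite cycle3_rot //; apply: all_b => //; rewrite eq_sym.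
- by rewrite -cycle3_rot ?all_b // 1?eq_sym.
- exact: GS.
Qed.

Lemma has_cycles3_extend G S a b c : has_cycles3 G S -> 2 < #|S| ->
  a \in S -> b \notin S -> c != a -> c != b -> cycle3 a b c \in G ->
  has_cycles3 G (b |: S).
Proof.
move=> GS S3 aS bS ca cb Gabc.
have ab : a != b by apply: contraNneq bS => <-.
have [cS|cS] := boolP (c \in S).
  by apply: (has_cycles3_pair (x0 := c) (y0 := a)) => //;
     rewrite -cycle3_rot // eq_sym.
(* When [c] lies outside [S], conjugating [cycle3 a x y], with [x] and [y] in [S], by [cycle3 a b c]
   yields [cycle3 b x y]. *)
have [x [xS xa _]] := exists_third a a S3.
have [y [yS ya yx]] := exists_third a x S3.
apply: (has_cycles3_pair (x0 := x) (y0 := y)) => //; first by rewrite eq_sym.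
have neS u v : u \in S -> v \notin S -> u != v by move=> uS; apply: contraNneq => <-.
have Gaxy : cycle3 a x y \in G by apply: GS => //; rewrite eq_sym.
have := groupJ Gaxy Gabc; rewrite cycle3J cycle3E1 1?[b == c]eq_sym //.
by rewrite !cycle3E // neS.
Qed.

(** An even permutation is a product of pairs of transpositions; inserting [tperm a c] twice reduces
    a disjoint pair to pairs that share a point. *)
Lemma Alt_sub_cycles3 G : has_cycles3 G setT -> 'Alt_X \subset G.
Proof.
move=> GT; apply/subsetP => s; rewrite Alt_even.
have tt a b c d : a != b -> c != d -> tperm a b * tperm c d \in G.
  have t3 x y z : x != y -> x != z -> tperm x y * tperm x z \in G.
    have [->|yz] := eqVneq y z; first by rewrite tperm2 group1.
    by move=> xy xz; apply: GT; rewrite ?inE.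
  move=> ab cd; have [ac|ac] := eqVneq a c; first by rewrite -ac t3 // ac.
  have [ad|ad] := eqVneq a d; first by rewrite (tpermC c) -ad t3 // ad eq_sym.
  have -> : tperm a b * tperm c d = tperm a b * tperm a c * (tperm c a * tperm c d).
    by rewrite (tpermC c a) -!mulgA (mulgA (tperm a c)) tperm2 mul1g.
  by rewrite groupM ?t3 // eq_sym.
have [ts -> dts] := prod_tpermP s; rewrite odd_perm_prod //.
elim: {ts}(size ts) {-2}ts (leqnn (size ts)) dts => [|n IH] [|u [|v ts]] //=.
- by rewrite big_nil group1.
- by rewrite big_nil group1.
rewrite negbK !big_cons mulgA => /ltnW szts /and3P[du dv dts] ev.
by rewrite groupM ?tt // IH.
Qed.

(** The set [S] whose 3-cycles all lie in [G] grows from [[set m; x; y]]: if [p i] moves some [z]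
    out of [S], the conjugate of [cycle3 m z c] by [p i] links [p i m], still in [S], to the new
    point [p i z]. *)
Lemma Alt_sub_transitive (I : Type) (p : I -> {perm X}) G m x y :
  (forall i, p i \in G) ->
  (forall S, (forall i z, z \in S -> p i z \in S) -> m \in S -> S = setT) ->
  m != x -> x != y -> m != y -> cycle3 m x y \in G ->
  (forall i, p i m \in [set m; x; y]) ->
  'Alt_X \subset G.
Proof.
move=> pG ptr mx xy my Gm pm; apply: Alt_sub_cycles3.
have G3 : has_cycles3 G [set m; x; y].
  move=> a b c; rewrite !inE -!orbA.
  have Gs := cycle3_sym Gm.
  have r1 : cycle3 x y m \in G by rewrite -cycle3_rot.
  have r2 : cycle3 y m x \in G by rewrite -cycle3_rot // eq_sym.
  do 3 case/or3P => /eqP->; rewrite ?eqxx // => _ _ _; exact: cycle3_sym.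
have : [set m; x; y] \subset [set m; x; y] by [].
move: {1 3}[set m; x; y] G3 => S.
elim: {S}#|~: S| {-2}S (leqnn #|~: S|) => [|n IH] S.
  rewrite leqn0 cards_eq0 => /eqP E GS _; by rewrite -setC0 -E setCK.
move=> Sn GS sS.
have mS : m \in S by apply: (subsetP sS); rewrite !inE eqxx.
have S3 : 2 < #|S|.
  by apply: leq_trans (subset_leq_card sS); rewrite setUC cardsU1 cards2 mx !inE !(eq_sym y) negb_or my xy.
case: (pselect (forall i z, z \in S -> p i z \in S)) => [Sinv|nS].
  by rewrite -(ptr S).
have [i [z [zS pzS]]] : exists i z, z \in S /\ p i z \notin S.
  apply: contrapT => H; apply: nS => i z zS.
  by apply: contrapT => /negP pzS; apply: H; exists i, z.
have [c [cS cm cz]] := exists_third m z S3.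
have pmS : p i m \in S by apply: (subsetP sS); exact: pm.
have mz : m != z by apply: contraNneq pzS => <-.
apply: (IH (p i z |: S)).
- rewrite -ltnS; apply: leq_trans Sn; apply: proper_card.
  by rewrite setCU properE subsetIr subsetI; apply/nandP; left; apply/subsetPn;
     exists (p i z); rewrite !inE // negbK.
- apply: (has_cycles3_extend (a := p i m) (c := p i c)) => //; rewrite ?(inj_eq perm_inj) //.
  by rewrite -cycle3J groupJ // GS // 1?eq_sym.
- exact: subset_trans (subsetUr _ _).
Qed.

End ThreeCycles.

(** * Finite transitive actions and their extensions *)

Section Wsets.
Variables (I : finType) (e : rel I).
Hypotheses (e_sym : symmetric e) (e_irr : irreflexive e).

(** Transitivity is stated through invariant predicates; since the generators act by involutions,
    invariance in one direction suffices. *)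
Record wset := Wset {
  pt :> finType;
  act : I -> pt -> pt;
  actK : forall i, involutive (act i);
  actC : forall i j, e i j -> forall x, act i (act j x) = act j (act i x);
  act_trans : forall P : pt -> Prop, (forall i x, P x -> P (act i x)) ->
    forall x y, P x -> P y }.

(** Twice the number of transpositions in the involution [act i]: a record of its sign that is easy
    to update under extensions. *)
Definition moved (X : wset) (i : I) : nat := \sum_(x : X) (act i x != x).

(* The loops labelled [g] at the points of [O] are opened up: [g] exchanges [O]
   with a copy of it, on which only the neighbours of [g] act nontrivially. *)
Section AddLayer.
Variables (X : wset) (g : I) (O : {set X}).
Hypotheses (Ofix : forall x, x \in O -> act g x = x)
  (Ostable : forall i, e i g -> forall x, x \in O -> act i x \in O)
  (O_gt0 : O != set0).

Definition layer_pt : finType := (X + {x : X | x \in O})%type.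

Definition layer_act (i : I) (u : layer_pt) : layer_pt :=
  match u with
  | inl x => if i == g then if insub x is Some o then inr o else inl (act g x)
             else inl (act i x)
  | inr o => if i == g then inl (val o)
             else if e i g then inr (insubd o (act i (val o))) else inr o
  end.

Lemma act_notin i x : (i == g) || e i g -> x \notin O -> act i x \notin O.
Proof.
move=> ig; apply: contraNN => xO.
case/orP: ig xO => [/eqP-> xO|/Ostable eO /eO]; last by rewrite actK.
by have := Ofix xO; rewrite actK => ->.
Qed.

Lemma layer_actK i : involutive (layer_act i).
Proof.
case=> [x|o]; rewrite /layer_act; have [_|ig] := eqVneq i g.
- case: insubP => [o xO xE|xO]; rewrite ?eqxx ?xE //.
  by rewrite insubN ?actK // act_notin ?eqxx.
- by rewrite actK.
- by rewrite valK.
- case: (boolP (e i g)) => eig; rewrite ?eig ?(negPf eig) //.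
  have oO := valP o; congr inr; apply: val_inj.
  by rewrite !val_insubd !(Ostable eig oO) actK oO.
Qed.

Lemma layer_actC i j : e i j -> forall u, layer_act i (layer_act j u) = layer_act j (layer_act i u).
Proof.
have main k : e k g -> forall u, layer_act k (layer_act g u) = layer_act g (layer_act k u).
  move=> kg; have kNg : k != g by apply: contraTneq kg => ->; rewrite e_irr.
  case=> [x|o]; rewrite /layer_act !eqxx !(negPf kNg) ?kg ?eqxx; last first.
    by rewrite val_insubd Ostable // (valP o).
  case: insubP => [o xO xE|xO]; rewrite ?(negPf kNg) ?kg ?eqxx; last first.
    by rewrite insubN ?(actC kg) // act_notin ?kg ?orbT.
  rewrite insubT ?Ostable // => kxO; congr inr; apply: val_inj.
  by rewrite val_insubd xE kxO.
move=> ij u; have [E|ig] := eqVneq i g.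
  by rewrite E main // e_sym -E.
have [E|jg] := eqVneq j g; first by rewrite E -main // -E.
case: u => [x|o]; rewrite /layer_act (negPf ig) (negPf jg) ?(actC ij) //.
case: (boolP (e i g)) => eig; case: (boolP (e j g)) => ejg;
  rewrite ?eig ?ejg ?(negPf eig) ?(negPf ejg) //.
have oO := valP o; congr inr; apply: val_inj.
rewrite !val_insubd !(Ostable eig oO) !(Ostable ejg oO) (actC ij).
by rewrite -(actC ij) !Ostable // (actC ij) .
Qed.

Lemma layer_trans (P : layer_pt -> Prop) : (forall i u, P u -> P (layer_act i u)) ->
  forall u v, P u -> P v.
Proof.
move=> Pact.
have Pl x y : P (inl x) -> P (inl y).
  apply: (act_trans (P := fun x => P (inl x))) => i z /(Pact i) /=.
  case: eqP => // ->; case: insubP => // o zO zE.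
  by move=> /(Pact g) /=; rewrite eqxx zE Ofix.
have Pr o : P (inr o) <-> P (inl (val o)).
  split=> [/(Pact g)|/(Pact g)] /=; rewrite ?eqxx //.
  by rewrite valK.
by move=> [x|o] [y|o'] /=; rewrite ?Pr; apply: Pl.
Qed.

Definition add_layer := Wset layer_actK layer_actC layer_trans.

Lemma act_layer_inl i (x : X) : ~~ ((i == g) && (x \in O)) ->
  act i (inl x : add_layer) = inl (act i x).
Proof. by rewrite /=; case: eqP => //= ->; case: insubP => // o ->. Qed.

Lemma act_layer_inlO (x : X) (xO : x \in O) :
  act g (inl x : add_layer) = inr (Sub x xO).
Proof. by rewrite /= eqxx insubT. Qed.

Lemma act_layer_inrg o : act g (inr o : add_layer) = inl (val o).
Proof. by rewrite /= eqxx. Qed.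

Lemma act_layer_inr i o : i != g -> (e i g -> act i (val o) = val o) ->
  act i (inr o : add_layer) = inr o.
Proof.
move=> ig; rewrite /= (negPf ig); case: ifP => // eig /(_ isT) ->.
by congr inr; apply: val_inj; rewrite val_insubd if_same.
Qed.

Lemma moved_add_layer : (forall i x, e i g -> x \in O -> act i x = x) ->
  forall i, moved add_layer i = moved X i + (i == g) * #|O|.*2.
Proof.
move=> Ofixl i; rewrite /moved big_sumType.
have -> : \sum_(o : {x : X | x \in O}) (act i (inr o : add_layer) != inr o) = (i == g) * #|O|.
  have [->|ig] := eqVneq i g.
    under eq_bigr do rewrite act_layer_inrg.
    by rewrite sum1_card card_sig mul1n; apply: eq_card.
  rewrite big1 // => o _; rewrite act_layer_inr ?eqxx // => eig.
  by rewrite Ofixl ?(valP o).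
rewrite -addnn mulnDr addnA; congr addn.
have [->|ig] := eqVneq i g; last first.
  rewrite addn0; apply: eq_bigr => x _.
  by rewrite act_layer_inl ?(negPf ig).
rewrite mul1n -sum1_card [\sum_(x in O) _]big_mkcond -big_split.
apply: eq_bigr => x _; case: (boolP (x \in O)) => xO.
  by rewrite act_layer_inlO Ofix // eqxx.
by rewrite act_layer_inl ?(negPf xO) ?andbF // [RHS]addn0.
Qed.

End AddLayer.

(* Doubling [X] makes every generator an even permutation; crossing the two
   copies over along [O] keeps the action transitive. *)
Section Twist.
Variables (X : wset) (g : I) (O : {set X}).
Hypotheses (Ofix : forall x, x \in O -> act g x = x)
  (Ostable : forall i, e i g -> forall x, x \in O -> act i x \in O)
  (O_gt0 : O != set0).

Definition twist_act (i : I) (u : X * bool) : X * bool :=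
  (act i u.1, u.2 (+) ((i == g) && (u.1 \in O))).

Lemma act_in i x : (i == g) || e i g -> (act i x \in O) = (x \in O).
Proof.
move=> ig; apply/idP/idP => xO; apply: contraTT xO => /(act_notin Ofix Ostable ig) //.
by rewrite actK.
Qed.

Lemma twist_actK i : involutive (twist_act i).
Proof.
move=> [x b]; rewrite /twist_act /= actK; congr pair.
by case: eqP => [->|_] /=; rewrite ?addbF // act_in ?eqxx // addbK.
Qed.

Lemma twist_actC i j : e i j -> forall u, twist_act i (twist_act j u) = twist_act j (twist_act i u).
Proof.
move=> ij [x b]; rewrite /twist_act /= (actC ij); congr pair.
have [ig|ig] := eqVneq i g; have [jg|jg] := eqVneq j g; rewrite /= ?addbF //.
- by rewrite ig jg e_irr in ij.
- by rewrite act_in // e_sym -ig ij orbT.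
- by rewrite act_in // -jg ij orbT.
Qed.

Lemma twist_trans (P : X * bool -> Prop) : (forall i u, P u -> P (twist_act i u)) ->
  forall u v, P u -> P v.
Proof.
move=> Pact [x b] v Pu; have [z zO] := set0Pn _ O_gt0.
have [c Pz] : exists c, P (z, c).
  apply: (act_trans (P := fun y => exists c, P (y, c)) _ (x := x)); last by exists b.
  by move=> i y [c /(Pact i)] H; eexists; exact: H.
(* At [z], which [g] fixes in [X], the generator [g] merely switches the two sheets. *)
have Pz' c' : P (z, c').
  have [->//|] := eqVneq c' c; move: (Pact g _ Pz).
  by rewrite /twist_act /= eqxx zO Ofix //=; move: Pz; case: c c' => [] [].
suff Pall y : P (y, true) /\ P (y, false) by case: v => y []; case: (Pall y).
apply: (act_trans (P := fun y => P (y, true) /\ P (y, false)) _ (x := z)) => // i {}y [Pt Pf].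
move: (Pact i _ Pt) (Pact i _ Pf); rewrite /twist_act /=.
by case: (_ && _).
Qed.

Definition twist := @Wset (X * bool)%type twist_act twist_actK twist_actC twist_trans.

Lemma act_twist i (x : X) b : ~~ ((i == g) && (x \in O)) -> act i ((x, b) : twist) = (act i x, b).
Proof. by move=> /negPf /= H; rewrite /twist_act /= H addbF. Qed.

Lemma moved_twist i : moved twist i = (moved X i + (i == g) * #|O|).*2.
Proof.
rewrite /moved -(pair_bigA _ (fun x b => (act i ((x, b) : twist) != (x, b)) : nat)) /=.
have -> : (i == g) * #|O| = \sum_(x : X) ((i == g) && (x \in O)).
  by rewrite -sum1_card big_distrr /= big_mkcond; apply: eq_bigr => x _; case: eqP; case: ifP.
rewrite -big_split -muln2 big_distrl; apply: eq_bigr => x _; rewrite big_bool.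
rewrite /twist_act /= !xpair_eqE; case: (boolP ((i == g) && (x \in O))) => [/andP[/eqP-> xO]|_].
  by rewrite Ofix ?eqxx.
by rewrite !andbT addn0 muln2 addnn.
Qed.

End Twist.
End Wsets.

(** Multiplying by [tperm x (s x)] removes two moved points and flips the sign; the induction is on
    the number of moved points. *)
Lemma odd_perm_involution (X : finType) (s : {perm X}) : involutive s ->
  exists k, \sum_(x : X) (s x != x) = k.*2 /\ odd_perm s = odd k.
Proof.
elim: {s}_.+1 {-2}s (ltnSn (\sum_(x : X) (s x != x))) => // n IH s sn sK.
case: (pickP (fun x => s x != x)) => [x sx|s1]; last first.
  have -> : s = 1%g by apply/permP => x; rewrite perm1; apply/eqP; move: (s1 x) => /negbFE.
  by exists 0; rewrite odd_perm1; split=> //; apply: big1 => x _; rewrite perm1 eqxx.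
pose s' := (tperm x (s x) * s)%g.
have s'E y : s' y = if (y == x) || (y == s x) then y else s y.
  rewrite permM; case: tpermP => [->|->|/eqP/negPf-> /eqP/negPf->] //.
    by rewrite eqxx sK.
  by rewrite eqxx orbT.
have s'K : involutive s'.
  move=> y; rewrite !s'E; case: (boolP ((y == x) || _)) => [->//|].
  rewrite negb_or => /andP[yx ysx].
  by rewrite (inj_eq perm_inj) -{1}(sK x) (inj_eq perm_inj) (negPf ysx) (negPf yx) sK.
have sum' : \sum_(y : X) (s y != y) = (\sum_(y : X) (s' y != y)).+2.
  rewrite (bigD1 x) // (bigD1 (s x)) //= sx sK eq_sym sx.
  rewrite [in RHS](bigD1 x) // [in RHS](bigD1 (s x)) //= !s'E !eqxx orbT eqxx.
  rewrite add0n add0n !add1n; do 2 congr S; apply: eq_bigr => y /andP[yx ysx].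
  by rewrite s'E (negPf yx) (negPf ysx).
have [|k [E o]] := IH s' _ s'K; first by rewrite -ltnS (leq_trans _ sn) // sum'.
exists k.+1; rewrite sum' E; split=> //=.
by rewrite -o odd_mul_tperm eq_sym sx /= negbK.
Qed.

(** * The gadget producing a 3-cycle *)

Section Gadget.
Variable L : nat.
Local Notation n := (L.*2.+2).
Implicit Types (k : 'I_n) (b c : bool).

(** Along the path of indices, [shift_even] swaps the ends of the edges that start at an even index,
    [shift_odd] those of the edges that start at an odd one. The default of [insubd] makes
    [shift_odd] fix the last index. *)
Definition shift_even k : 'I_n := insubd k (if odd k then k.-1 else k.+1).
Definition shift_odd k : 'I_n := insubd k (if odd k then k.+1 else k.-1).

Lemma val_shift_even k : shift_even k = (if odd k then k.-1 else k.+1) :> nat.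
Proof. by rewrite val_insubd ifT //; have := ltn_ord k; case: ifP; lia. Qed.

Lemma val_shift_odd k :
  shift_odd k = (if odd k then if k.+1 == n then nat_of_ord k else k.+1 else k.-1) :> nat.
Proof.
rewrite val_insubd /=; have := ltn_ord k.
by case: (boolP (odd k)) => ok; case: (boolP (k.+1 == n)) => E; case: ifP; lia.
Qed.

Lemma shift_evenK : involutive shift_even.
Proof.
move=> k; apply: val_inj; rewrite /= !val_shift_even.
by case: (boolP (odd k)) => ok; case: ifP; lia.
Qed.

Lemma shift_oddK k : k != ord0 -> shift_odd (shift_odd k) = k.
Proof.
rewrite -val_eqE => k0; apply: val_inj; move: k0; rewrite /= !val_shift_odd; have := ltn_ord k.
by case: (boolP (odd k)) => ok; case: (boolP (k.+1 == n)) => E; rewrite ?ok ?E //;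
   case: ifP => //; try case: ifP; lia.
Qed.

Lemma shift_odd_eq0 k : k != ord0 -> shift_odd k != ord0.
Proof. by rewrite -!val_eqE /= val_shift_odd; case: ifP; try case: ifP; lia. Qed.

(* [inl true] is the common end of the two arms [inr (b, _)]; with the first
   points of the arms and [inl false], where the gadget is attached, it forms a
   square for the two commuting generators. *)
Definition gadget : finType := (bool + bool * 'I_n)%type.

(** The test [c == b] makes the two steps run along the two pairs of opposite sides of the square.
    Beyond its first point, an arm is moved only by its own step. *)
Definition arm_step b (g : gadget) : gadget :=
  match g with
  | inl c => inr (c == b, ord0)
  | inr (c, k) => if k == ord0 then inl (c == b)
                  else if c == b then inr (c, shift_odd k) else g
  end.

Definition even_step (g : gadget) : gadget :=
  match g with inl c => inl c | inr (c, k) => inr (c, shift_even k) end.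

Lemma arm_stepK b : involutive (arm_step b).
Proof.
case=> [c|[c k]] /=; first by case: b c => [] [].
case: eqP => [->|/eqP k0] /=; first by case: b c => [] [].
case: eqP => [->|/eqP cb] /=; last by rewrite (negPf k0) (negPf cb).
by rewrite (negPf (shift_odd_eq0 k0)) eqxx shift_oddK.
Qed.

Lemma even_stepK : involutive even_step.
Proof. by case=> [c|[c k]] //=; rewrite shift_evenK. Qed.

Lemma arm_stepC b c g : arm_step b (arm_step c g) = arm_step c (arm_step b g).
Proof.
have [->//|bc] := eqVneq b c.
case: g => [d|[d k]] /=; first by case: b c d bc => [] [] [].
case: (eqVneq k ord0) => [_|k0] /=; first by case: b c d bc => [] [] [].
by case: b c d bc => [] [] [] //= _; rewrite ?(negPf (shift_odd_eq0 k0)) (negPf k0).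
Qed.

End Gadget.

Definition wperm (I : finType) (e : rel I) (X : wset e) (i : I) : {perm X} :=
  perm (can_inj (@actK I e X i)).

Definition gens (I : finType) (e : rel I) (X : wset e) : {set {perm X}} :=
  [set wperm X i | i in [set: I]].

Section AddGadget.
Variables (I : finType) (e : rel I).
Hypotheses (e_sym : symmetric e) (e_irr : irreflexive e).
Variables (X : wset e) (y : X) (L : nat) (s t u : I).
Hypotheses (esu : e s u) (est : ~~ e s t) (etu : ~~ e t u) (st : s != t) (tu : t != u).
Hypothesis y_fix : forall i, i != s -> i != u -> act i y = y.

Lemma neq_su : s != u.
Proof. by apply: contraTneq esu => ->; rewrite e_irr. Qed.

Definition gadget_step (i : I) : gadget L -> gadget L :=
  if i == s then arm_step true else if i == u then arm_step false
  else if i == t then @even_step L else id.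

Definition gadget_pt : finType := (X + gadget L)%type.

Definition gadget_act (i : I) (v : gadget_pt) : gadget_pt :=
  match v with
  | inl x => if (i == t) && (x == y) then inr (inl false) else inl (act i x)
  | inr g => if (i == t) && (g == inl false) then inl y else inr (gadget_step i g)
  end.

Lemma gadget_step_s : gadget_step s = arm_step true.
Proof. by rewrite /gadget_step eqxx. Qed.
Lemma gadget_step_u : gadget_step u = arm_step false.
Proof. by rewrite /gadget_step eqxx eq_sym (negPf neq_su). Qed.
Lemma gadget_step_t : gadget_step t = @even_step L.
Proof. by rewrite /gadget_step eqxx eq_sym (negPf st) (negPf tu). Qed.
Lemma gadget_step_id i : i != s -> i != t -> i != u -> gadget_step i = id.
Proof. by rewrite /gadget_step => /negPf-> /negPf-> /negPf->. Qed.

Lemma y_fixt : act t y = y. Proof. by apply: y_fix; rewrite // eq_sym. Qed.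

Lemma gadget_stepK i : involutive (gadget_step i).
Proof.
rewrite /gadget_step; case: ifP => _; first exact: arm_stepK.
case: ifP => _; first exact: arm_stepK.
by case: ifP => _ //; exact: even_stepK.
Qed.

Lemma gadget_actK i : involutive (gadget_act i).
Proof.
have [->|it] := eqVneq i t; last first.
  by case=> [x|g]; rewrite /gadget_act (negPf it) /= ?actK ?gadget_stepK.
case=> [x|g] /=; rewrite eqxx /=.
  case: eqP => [->|/eqP xy] /=; first by rewrite !eqxx.
  by rewrite eqxx -{1}y_fixt (inj_eq (can_inj (actK t))) (negPf xy) actK.
case: eqP => [->|/eqP gd] /=; first by rewrite !eqxx.
rewrite eqxx gadget_step_t even_stepK; case: eqP => //= E.
by move: gd; rewrite -(even_stepK g) E eqxx.
Qed.

(** The critical pairs involve [t]: a neighbour of [t] is neither [s] nor [u], hence fixes [y] and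
    acts trivially on the gadget. *)
Lemma gadget_actC i j : e i j ->
  forall v, gadget_act i (gadget_act j v) = gadget_act j (gadget_act i v).
Proof.
have main k : e k t -> forall v, gadget_act k (gadget_act t v) = gadget_act t (gadget_act k v).
  move=> kt; have ks : k != s by apply: contraNneq est => <-.
  have ku : k != u by apply: contraNneq etu => <-; rewrite e_sym.
  have kNt : k != t by apply: contraTneq kt => ->; rewrite e_irr.
  have kid := gadget_step_id ks kNt ku.
  case=> [x|g] /=; rewrite !eqxx !(negPf kNt) /= ?kid.
    have := inj_eq (can_inj (actK k)) x y; rewrite y_fix // => ->.
    by case: eqP => _ /=; rewrite ?(negPf kNt) ?eqxx /= ?kid ?(actC kt).
  by case: (eqVneq g (inl false)) => [->|gd] /=; rewrite ?(negPf kNt) ?eqxx /= ?y_fix ?kid ?(negPf gd).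
move=> ij v; have [E|it] := eqVneq i t; first by rewrite E main // e_sym -E.
have [E|jt] := eqVneq j t; first by rewrite E -main // -E.
case: v => [x|g]; rewrite /gadget_act (negPf it) (negPf jt) /= ?(actC ij) //.
congr inr; rewrite /gadget_step (negPf it) (negPf jt).
by case: (i == s); case: (i == u); case: (j == s); case: (j == u); rewrite // arm_stepC.
Qed.

Lemma gadget_trans (P : gadget_pt -> Prop) : (forall i v, P v -> P (gadget_act i v)) ->
  forall v w, P v -> P w.
Proof.
move=> Pact.
have Pact' i v : P (gadget_act i v) <-> P v.
  by split=> [/(Pact i)|/(Pact i)]; rewrite ?gadget_actK.
have Pl x x' : P (inl x) -> P (inl x').
  apply: (act_trans (P := fun x => P (inl x))) => i z Pz.
  have [E|H] := boolP ((i == t) && (z == y)); last by move: (Pact i _ Pz); rewrite /= (negPf H).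
  by case/andP: E Pz => /eqP-> /eqP->; rewrite y_fixt.
have Pd : P (inr (inl false)) <-> P (inl y) by rewrite -(Pact' t (inl y)) /= !eqxx.
have Ps g : P (inr (arm_step true g)) <-> P (inr g).
  by rewrite -(Pact' s (inr g)) /= (negPf st) gadget_step_s.
have Pu g : P (inr (arm_step false g)) <-> P (inr g).
  by rewrite -(Pact' u (inr g)) /= eq_sym (negPf tu) gadget_step_u.
have Pt c k : P (inr (inr (c, shift_even k))) <-> P (inr (inr (c, k))).
  by rewrite -(Pact' t (inr (inr (c, k)))) /= eqxx gadget_step_t.
have P0 c : P (inr (inr (c, ord0))) <-> P (inl y).
  by rewrite -Pd; case: c; [rewrite -(Pu (inl false))|rewrite -(Ps (inl false))].
have Pm c : P (inr (inl c)) <-> P (inl y).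
  by rewrite -(Ps (inl c)) /= P0.
have Pa c k : P (inr (inr (c, k))) <-> P (inl y).
  case: k => k; elim: k => [|k IH] kn.
    by rewrite -(P0 c); have -> : Ordinal kn = ord0 by exact: val_inj.
  rewrite -(IH (ltnW kn)); set k' := Ordinal (ltnW kn).
  have [ok|ek] := boolP (odd k); last first.
    rewrite -(Pt c k'); have -> // : Ordinal kn = shift_even k'.
    by apply: val_inj; rewrite /= val_shift_even /= (negPf ek).
  have -> : Ordinal kn = shift_odd k'.
    by apply: val_inj; rewrite /= val_shift_odd /= ok; case: eqP => // E; have := kn; rewrite E ltnn.
  have k'0 : k' != ord0 by apply: contraTneq ok => /(congr1 val) /= ->.
  by case: c {IH} => /=; [rewrite -[X in _ <-> X]Ps|rewrite -[X in _ <-> X]Pu] => /=;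
     rewrite (negPf k'0).
have PE v : P v <-> P (inl y).
  by case: v => [x|[c|[c k]]]; [split; exact: Pl | exact: Pm | exact: Pa].
by move=> v w /PE ?; apply/PE.
Qed.

Definition add_gadget := Wset gadget_actK gadget_actC gadget_trans.


Lemma act_gadget_inl i (x : X) : ~~ ((i == t) && (x == y)) ->
  act i (inl x : add_gadget) = inl (act i x).
Proof. by move=> /negPf /= ->. Qed.

Local Open Scope group_scope.

Definition arm_gen b := if b then s else u.

Lemma act_arm_gen b g : act (arm_gen b) (inr g : add_gadget) = inr (arm_step b g).
Proof.
case: b => /=; first by rewrite (negPf st) gadget_step_s.
by rewrite eq_sym (negPf tu) gadget_step_u.
Qed.

Lemma act_t g : g != inl false -> act t (inr g : add_gadget) = inr (even_step g).
Proof. by move=> /negPf gd; rewrite /= eqxx gd gadget_step_t. Qed.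

Definition arm_rot b : {perm add_gadget} := wperm add_gadget (arm_gen b) * wperm add_gadget t.

Definition arm_pt b k : add_gadget := inr (inr (b, inord k)).
Definition center : add_gadget := inr (inl true).

Lemma arm_rot0 b : arm_rot b (arm_pt b 0) = center.
Proof.
have E0 : inord 0 = ord0 :> 'I_L.*2.+2 by apply: val_inj; rewrite /= inordK.
by rewrite permM !permE act_arm_gen [arm_step _ _]/= E0 !eqxx act_t.
Qed.

Lemma arm_rot_center b : arm_rot b center = arm_pt b 1.
Proof.
by rewrite permM !permE act_arm_gen [arm_step _ _]/= (_ : (true == b) = b) ?act_t.
Qed.

(** Odd indices travel outwards and even ones inwards; at the last index the arm generator has a
    loop, and the rotation turns back. *)
Lemma arm_rotE b k : 0 < k < L.*2.+2 ->
  arm_rot b (arm_pt b k) =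
  arm_pt b (if odd k then if k == L.*2.+1 then L.*2 else k.+2 else k.-2).
Proof.
move=> /andP[k0 kn].
rewrite permM !permE act_arm_gen [arm_step _ _]/= -val_eqE [_ == _ :> nat]/=.
rewrite inordK // -(negbK (k == 0)) -lt0n k0 eqxx act_t //.
rewrite /arm_pt [even_step _]/=; congr (inr (inr (b, _))); apply: val_inj.
rewrite /= val_shift_even val_shift_odd inordK //.
rewrite eqSS; case: (boolP (odd k)) => ok; case: (boolP (k == L.*2.+1)) => E;
  by rewrite inordK; try case: ifP; lia.
Qed.

Lemma arm_rot_out b j : j <= L -> (arm_rot b ^+ j.+1) center = arm_pt b j.*2.+1.
Proof.
elim: j => [|j IH] jL; first by rewrite expg1 arm_rot_center.
rewrite expgSr permM IH 1?ltnW // arm_rotE; last lia.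
by rewrite /= odd_double /=; case: eqP => //; lia.
Qed.

(** The exponent [L.+2] counts [L.+1] steps from the centre to the end of the arm and one step
    turning back. *)
Lemma arm_rot_in b j : j <= L -> (arm_rot b ^+ (L.+2 + j)) center = arm_pt b (L - j).*2.
Proof.
elim: j => [|j IH] jL.
  rewrite addn0 subn0 expgSr permM arm_rot_out // arm_rotE; last lia.
  by rewrite /= odd_double eqxx.
rewrite addnS expgSr permM IH 1?ltnW // arm_rotE; last lia.
by rewrite odd_double /=; congr arm_pt; lia.
Qed.

Lemma arm_rot_cycle b : (arm_rot b ^+ L.*2.+3) center = center.
Proof.
have -> : L.*2.+3 = (L.+2 + L).+1 by lia.
by rewrite expgSr permM arm_rot_in // subnn arm_rot0.
Qed.

Local Notation N := (#|X| + 3)`!.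

Definition arm_set b : {set add_gadget} :=
  [set v | match v with inr (inl true) => true | inr (inr (c, _)) => c == b | _ => false end].

Definition arm_rest b : {set add_gadget} :=
  [set inl x | x in [set: X]] :|:
  [set v in [:: inr (inl false); inr (inr (~~ b, ord0)); arm_pt (~~ b) 1]].

Lemma card_arm_rest b : #|arm_rest b| <= #|X| + 3.
Proof.
apply: leq_trans (leq_card_setU _ _) _; apply: leq_add.
  by rewrite -cardsT; exact: leq_imset_card.
rewrite cardsE; exact: card_size.
Qed.

Lemma arm_rest_rot b v : v \in arm_rest b -> arm_rot b v \in arm_rest b.
Proof.
have gt : arm_gen b != t by rewrite /arm_gen; case: b; rewrite // eq_sym.
have inlR x : inl x \in arm_rest b by rewrite inE imset_f ?inE.
have deltaR : inr (inl false) \in arm_rest b by rewrite !inE eqxx orbT.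
have shift0 : shift_even ord0 = inord 1 :> 'I_L.*2.+2 by [].
have b1R : arm_pt (~~ b) 1 \in arm_rest b by rewrite !inE eqxx !orbT.
rewrite permM !permE => vR; have H := vR; rewrite !inE in H.
case/or4P: H => [/imsetP[x _ E]|/eqP E|/eqP E|/eqP E]; rewrite {vR}E.
- rewrite act_gadget_inl ?(negPf gt) //.
  have [/andP[_ /eqP->]|H] := boolP ((t == t) && (act (arm_gen b) x == y)).
    by rewrite /= !eqxx.
  by rewrite act_gadget_inl.
- by rewrite act_arm_gen (_ : arm_step _ _ = inr (~~ b, ord0)) ?act_t //; case: (b).
- rewrite act_arm_gen [arm_step _ _]/= (_ : (~~ b == b) = false); last by case: (b).
  by rewrite /= !eqxx inlR.
- rewrite act_arm_gen [arm_step _ _]/= (_ : (~~ b == b) = false); last by case: (b).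
  rewrite ifN ?act_t // -?val_eqE /= ?inordK //.
  by rewrite -shift0 shift_evenK !inE eqxx !orbT.
Qed.

Lemma N_even : 2 %| N.
Proof. by apply: dvdn_fact; rewrite addn3. Qed.

(** Either [v] lies in [arm_rest b], an invariant set of at most [#|X| + 3] points, so that its
    cycle length divides [N]; or it lies further out on the other arm, where only [t] acts and the
    rotation has order two. *)
Lemma arm_rot_fix b v : v \notin arm_set b -> (arm_rot b ^+ N) v = v.
Proof.
move=> vb; have [vR|vR] := boolP (v \in arm_rest b).
  have porbR : porbit (arm_rot b) v \subset arm_rest b.
    apply/subsetP => _ /porbitP[k ->]; elim: k => [|k IH]; first by rewrite expg0 perm1.
    by rewrite expgSr permM arm_rest_rot.
  have /dvdnP[q ->] : #|porbit (arm_rot b) v| %| N.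
    apply: dvdn_fact; rewrite lt0n card_porbit_neq0 /=.
    exact: leq_trans (subset_leq_card porbR) (card_arm_rest b).
  rewrite mulnC expgM; elim: q => [|q IH]; rewrite ?expg0 ?perm1 //.
  by rewrite expgSr permM IH permX iter_porbit.
have /dvdnP[q ->] := N_even.
suff w2 : (arm_rot b ^+ 2) v = v.
  by rewrite mulnC expgM; elim: q => [|q IH]; rewrite ?expg0 ?perm1 // expgSr permM IH.
case: v vb vR => [x|[[]|[c k]]]; rewrite !inE ?eqxx ?orbT ?imset_f ?inE //.
move=> cb; rewrite !negb_or => /and4P[_ _ k0 k1].
have {cb} cE : c = ~~ b by case: c b cb {k0 k1} => [] [].
have stepk (k' : 'I_(L.*2.+2)) : 1 < k' ->
    arm_rot b (inr (inr (c, k'))) = inr (inr (c, shift_even k')).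
  move=> k'1; rewrite permM !permE act_arm_gen [arm_step _ _]/= cE.
  rewrite (_ : (~~ b == b) = false); last by case: (b).
  by rewrite ifN ?act_t // -val_eqE -lt0n ltnW.
have k2 : 1 < k.
  move: k0 k1; rewrite cE !(inj_eq (@inr_inj _ _)) !xpair_eqE eqxx -!val_eqE /= inordK //.
  by case: (nat_of_ord k) => [|[|]].
rewrite expgSr expg1 permM stepk // stepk ?shift_evenK //.
by rewrite val_shift_even; case: ifP; lia.
Qed.

Section Generation.
Hypothesis LN : (L.*2.+3 == N.+1) || (L.*2.+4 == N).

Local Notation gens := (gens add_gadget).

Lemma wperm_gens i : wperm add_gadget i \in <<gens>>.
Proof. by apply: mem_gen; apply: imset_f; rewrite inE. Qed.

(* On the arm [b] and the centre, [arm_rot b] is a cycle of length [N - 1] or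
   [N + 1], so that its [N]-th power there is the cycle or its inverse; all its
   other cycles have length dividing [N]. *)
Lemma arm_rot_power b : exists c, [/\ c \in <<gens>>,
  forall v, v \notin arm_set b -> c v = v & c center = arm_pt b 0].
Proof.
have wG : arm_rot b \in <<gens>> by rewrite groupM ?wperm_gens.
have [/eqP E|/eqP E] := orP LN.
  exists (arm_rot b ^+ N); split; [exact: groupX|exact: arm_rot_fix|].
  apply: (@perm_inj _ (arm_rot b)); rewrite arm_rot0 -permM -expgSr -E.
  exact: arm_rot_cycle.
exists (arm_rot b ^+ N)^-1; split.
- by rewrite groupV groupX.
- by move=> v vb; rewrite -{1}(arm_rot_fix vb) permK.
- apply: (canLR (permK _)).
  by rewrite -E expgS permM arm_rot0 arm_rot_cycle.
Qed.

(** The powers obtained for the two arms have supports meeting in the centre only, so their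
    commutator is a 3-cycle. Each generator sends the centre to itself or to the first point of an
    arm, and these three points are those of the 3-cycle. *)
Lemma Alt_sub_gens : 'Alt_add_gadget \subset <<gens>>.
Proof.
have [c [cG cfix cm]] := arm_rot_power true.
have [d [dG dfix dm]] := arm_rot_power false.
have neq_arm b : arm_pt b 0 != center by [].
have cd : [~ c, d] = cycle3 center (arm_pt false 0) (arm_pt true 0).
  rewrite (@commg_cycle3 _ c d center) ?cm ?dm; [|move|exact: neq_arm|exact: neq_arm].
    by rewrite cycle3_rot.
  move=> v vm; have [vt|vt] := boolP (v \in arm_set true); last by left; exact: cfix.
  right; apply: dfix; move: vt vm; rewrite !inE.
  by case: v => [?|[[]|[[] ?]]] //; rewrite eqxx.
apply: (@Alt_sub_transitive _ I (wperm add_gadget) _ center (arm_pt false 0) (arm_pt true 0)) => //.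
- exact: wperm_gens.
- move=> S Sinv mS; apply/setP => v; rewrite inE.
  apply: (@act_trans _ _ add_gadget (fun v => v \in S) _ center) => //.
  by move=> i w /(Sinv i); rewrite permE.
- by rewrite -cd groupR.
- move=> i; rewrite permE; have ord0E : inord 0 = ord0 :> 'I_L.*2.+2.
    by apply: val_inj; rewrite /= inordK.
  have [->|is_] := eqVneq i s; first by rewrite (act_arm_gen true) !inE /arm_pt ord0E eqxx !orbT.
  have [->|iu] := eqVneq i u; first by rewrite (act_arm_gen false) !inE /arm_pt ord0E eqxx !orbT.
  by rewrite /= andbF /gadget_step (negPf is_) (negPf iu); case: ifP => _; rewrite !inE eqxx.
Qed.

End Generation.

Local Close Scope group_scope.

Lemma sum_prod (A B : finType) (F : A * B -> nat) :
  \sum_p F p = \sum_a \sum_b F (a, b).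
Proof. by rewrite pair_bigA; apply: eq_bigr => -[]. Qed.

(** The four points of the square are moved, and on arm [b] the indices from 1 to [L.*2]. *)
Lemma moved_arm_step b : \sum_(g : gadget L) (arm_step b g != g) = L.*2 + 4.
Proof.
rewrite big_sumType big_bool sum_prod big_bool.
have main c : \sum_(k < L.*2.+2) (arm_step b (inr (c, k)) != inr (c, k)) =
    if c == b then L.*2.+1 else 1.
  case: eqP => [->|/eqP cb]; last first.
    rewrite (bigD1 ord0) //= big1 // => k k0; by rewrite (negPf k0) (negPf cb) eqxx.
  rewrite (bigD1 ord_max) //= eqxx.
  have -> : (inr (b, shift_odd ord_max) != inr (b, ord_max) :> gadget L) = false.
    apply/negbTE; rewrite negbK; apply/eqP; congr (inr (_, _)); apply: val_inj.
    by rewrite /= val_shift_odd /= odd_double eqxx.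
  rewrite add0n (eq_bigr (fun=> 1)) => [|k km].
    by rewrite sum1_card cardC1 card_ord.
  have [E|k0] := eqVneq k ord0 => //; apply/eqP; rewrite eqb1.
  apply/eqP => -[] /(congr1 val) /=; rewrite val_shift_odd; move: k0 km.
  by rewrite -!val_eqE /=; case: ifP => ok; [case: (boolP (k.+1 == _))|]; lia.
by rewrite !main {main}; case: b => /=; lia.
Qed.

Lemma moved_even_step : \sum_(g : gadget L) (even_step g != g) = L.*2.*2 + 4.
Proof.
rewrite big_sumType big_bool sum_prod /=.
rewrite (eq_bigr (fun=> L.*2.+2)) => [|c _]; last first.
  rewrite (eq_bigr (fun=> 1)) => [|k _]; first by rewrite sum1_card card_ord.
  apply/eqP; rewrite eqb1; apply/eqP => -[] /(congr1 val) /=; rewrite val_shift_even.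
  by case: ifP; lia.
by rewrite big_bool /=; lia.
Qed.

Lemma moved_add_gadget i : moved add_gadget i =
  moved X i + (i == t) * (L.*2.*2 + 6) + ((i == s) || (i == u)) * (L.*2 + 4).
Proof.
rewrite /moved big_sumType.
have [->|it] := eqVneq i t.
  rewrite [t == s]eq_sym (negPf st) (negPf tu) addn0 mul1n.
  have -> : \sum_x (act t (inl x : add_gadget) != inl x) = \sum_(x : X) (act t x != x) + 1.
    rewrite (bigD1 y) // [in RHS](bigD1 y) //= !eqxx y_fixt eqxx add0n addnC; congr addn.
    by apply: eq_bigr => x xy; rewrite (negPf xy).
  have -> : \sum_g (act t (inr g : add_gadget) != inr g) = \sum_(g : gadget L) (even_step g != g) + 1.
    rewrite (bigD1 (inl false)) // [in RHS](bigD1 (inl false)) //= !eqxx add0n addnC; congr addn.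
    by apply: eq_bigr => g gd; rewrite (negPf gd) gadget_step_t.
  by rewrite moved_even_step /= addnACA -!addnA; congr addn; lia.
rewrite addn0; congr addn.
  by apply: eq_bigr => x _; rewrite act_gadget_inl ?(negPf it).
have [->|is_] := eqVneq i s.
  by rewrite mul1n -(moved_arm_step true); apply: eq_bigr => g _; rewrite (act_arm_gen true).
have [->|iu] := eqVneq i u.
  by rewrite mul1n -(moved_arm_step false); apply: eq_bigr => g _; rewrite (act_arm_gen false).
by rewrite big1 // => g _; rewrite /= (negPf it) gadget_step_id ?eqxx.
Qed.

End AddGadget.

(** For [N = q * 4] the cycle length [L.*2.+3] is [N - 1] for the even choice of [L] and [N + 1] for
    the odd one. The gadget has [L + 2] edges for each of [s] and [u], so the parity of [L] decides
    their sign. *)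
Definition arm_half (even : bool) q := if even then q.-1.*2 else q.*2.-1.

Lemma arm_half_length even q N : 0 < q -> N = q * 4 ->
  ((arm_half even q).*2.+3 == N.+1) || ((arm_half even q).*2.+4 == N).
Proof. by rewrite /arm_half; case: even; lia. Qed.

(** Here [b] marks the generator [t], and [c] marks [s] and [u]. The summand 8 is 6 from the gadget
    and 2 from the compensating [t]-edge. *)
Lemma odd_half_moved even q k m (b c : bool) : 0 < q -> ~~ (b && c) ->
  m.*2.*2 + b * ((arm_half even q).*2.*2 + 8) + c * ((arm_half even q).*2 + 4) = k.*2 ->
  odd k = ~~ even && c.
Proof. by rewrite /arm_half; case: even b c => [] [] [] //= ? _; lia. Qed.

(** * Extensions with alternating or symmetric image *)

Section AltExtension.
Variables (I : finType) (e : rel I).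
Hypotheses (e_sym : symmetric e) (e_irr : irreflexive e).
Variables (s t u : I).
Hypotheses (esu : e s u) (est : ~~ e s t) (etu : ~~ e t u) (st : s != t) (tu : t != u).

Lemma moved_odd (X : wset e) i :
  exists k, moved X i = k.*2 /\ odd_perm (wperm X i) = odd k.
Proof.
have [|k [E o]] := @odd_perm_involution X (wperm X i).
  by move=> x; rewrite !permE actK.
exists k; split=> //; rewrite -E; apply: eq_bigr => x _; by rewrite permE.
Qed.

(* The point [z] first receives an [s]-neighbour [y1]. In the double, [y2 false]
   will carry the gadget, and a [t]-edge at [y2 true] compensates for the odd
   number of [t]-edges that the gadget brings. The number of [s]- and [u]-edges
   of the gadget is odd or even according to [L]. *)
Lemma alternating_extension (even : bool) (X : wset e) (z : X) :
  (forall i, i != t -> act i z = z) ->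
  exists (Y : wset e) (f : X -> Y),
  [/\ injective f, forall i x, x != z -> act i (f x) = f (act i x),
      ('Alt_Y \subset <<gens Y>>)%g &
      if even then forall i, ~~ odd_perm (wperm Y i)
      else exists i, odd_perm (wperm Y i)].
Proof.
move=> zfix.
have su : s != u by apply: contraTneq esu => ->; rewrite e_irr.
have ut : u != t by rewrite eq_sym.
have zs : forall x, x \in [set z] -> act s x = x by move=> x /set1P->; exact: zfix.
have zlk i x : e i s -> x \in [set z] -> act i x = x.
  by move=> eis /set1P->; apply: zfix; apply: contraTneq eis => ->; rewrite e_sym.
have zst i : e i s -> forall x, x \in [set z] -> act i x \in [set z].
  by move=> eis x xz; rewrite (zlk i).
pose X1 := add_layer e_sym e_irr zs zst.
pose z1 : X1 := inl z; pose y1 : X1 := inr (Sub z (set11 z)).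
have y1fix i : i != s -> act i y1 = y1.
  by move=> is_; apply: act_layer_inr => // eis; rewrite SubK; exact: zlk (set11 z).
have z1fix i : i != s -> i != t -> act i z1 = z1.
  by move=> is_ it; rewrite /z1 act_layer_inl ?(negPf is_) ?zfix.
have sz1 : act s z1 = y1 by exact: act_layer_inlO.
have sy1 : act s y1 = z1 by exact: act_layer_inrg.
have zy1 : z1 != y1 by [].
have zyu : forall x, x \in [set z1; y1] -> act u x = x.
  by move=> x /set2P[]->; rewrite ?z1fix ?y1fix // eq_sym.
have zyst i : e i u -> forall x, x \in [set z1; y1] -> act i x \in [set z1; y1].
  move=> eiu x xzy; have [->|is_] := eqVneq i s.
    by case/set2P: xzy => ->; rewrite ?sz1 ?sy1 !inE eqxx ?orbT.
  have it : i != t by apply: contraTneq eiu => ->.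
  by case/set2P: xzy => ->; rewrite ?z1fix ?y1fix // !inE eqxx ?orbT.
have zy0 : [set z1; y1] != set0 by apply/set0Pn; exists z1; rewrite !inE eqxx.
pose X2 := twist e_sym e_irr zyu zyst zy0.
(* In [X1] the point [y1] is moved by [s] only, so its two lifts are moved only by [s] and [u], as
   the gadget requires of its attaching point. *)
pose y2 b : X2 := (y1, b).
have y2fix i b : i != s -> i != u -> act i (y2 b) = y2 b.
  by move=> is_ iu; rewrite /y2 act_twist ?(negPf iu) // y1fix.
have lkt i : e i t -> (i != s) && (i != u).
  by move=> eit; apply/andP; split; apply: contraTneq eit => ->; rewrite // e_sym.
have yt : forall x, x \in [set y2 true] -> act t x = x.
  by move=> x /set1P->; rewrite y2fix // eq_sym.
have ylk i x : e i t -> x \in [set y2 true] -> act i x = x.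
  by move=> /lkt/andP[is_ iu] /set1P->; exact: y2fix.
have yst i : e i t -> forall x, x \in [set y2 true] -> act i x \in [set y2 true].
  by move=> eit x xy; rewrite (ylk i).
pose X3 := add_layer e_sym e_irr yt yst.
pose y3 : X3 := inl (y2 false).
have y3fix i : i != s -> i != u -> act i y3 = y3.
  have y2tf : y2 false \notin [set y2 true] by rewrite inE xpair_eqE andbF.
  by move=> is_ iu; rewrite /y3 act_layer_inl ?y2fix // (negPf y2tf) andbF.
have X3_gt0 : 0 < #|X3| by apply/card_gt0P; exists y3.
have /dvdnP[q Nq] : 4 %| (#|X3| + 3)`! by apply: dvdn_fact; rewrite addn3 ltnS.
have q_gt0 : 0 < q by have := fact_gt0 (#|X3| + 3); rewrite Nq muln_gt0 => /andP[].
pose L := arm_half even q.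
have LN : (L.*2.+3 == (#|X3| + 3)`!.+1) || (L.*2.+4 == (#|X3| + 3)`!).
  exact: arm_half_length.
pose Y := add_gadget e_sym e_irr L esu est etu st tu y3fix.
pose f x : Y := inl (inl (inl x, false)).
exists Y, f; split.
- by move=> x x' [].
- move=> i x xz; rewrite /f act_gadget_inl; last by apply/negP => /andP[_ /eqP].
  rewrite act_layer_inl; last by apply/negP => /andP[_ /set1P].
  rewrite act_twist; last by apply/negP => /andP[_ /set2P[] // [/eqP]]; exact/negP.
  by rewrite act_layer_inl // inE negb_and xz orbT.
- exact: Alt_sub_gens LN.
have movedE i : moved Y i = (moved X1 i + (i == u) * 2).*2 + (i == t) * 2 +
    (i == t) * (L.*2.*2 + 6) + ((i == s) || (i == u)) * (L.*2 + 4).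
  by rewrite moved_add_gadget moved_add_layer // cards1 moved_twist cards2 zy1.
have Yodd i : odd_perm (wperm Y i) = ~~ even && ((i == s) || (i == u)).
  have [k [kE ->]] := moved_odd Y i; have [k1 [k1E _]] := moved_odd X1 i.
  apply: (@odd_half_moved _ q k (k1 + (i == u)) (i == t)) => //.
    by apply/negP => /andP[/eqP->]; rewrite [t == s]eq_sym (negPf st) (negPf tu).
  rewrite -kE movedE k1E muln2 -doubleD -!addnA; congr addn.
  by rewrite [RHS]addnA -mulnDr (addnCA 2).
case: ifPn => evenE; first by move=> i; rewrite Yodd evenE.
by exists s; rewrite Yodd evenE eqxx.
Qed.

End AltExtension.

(** * Walks in the complement graph *)

Section Tail.
Variables (I : finType) (e : rel I).
Hypotheses (e_sym : symmetric e) (e_irr : irreflexive e).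
Variables (X : wset e) (g : I) (O : {set X}).
Hypotheses (Ofix : forall x, x \in O -> act g x = x)
  (Ostable : forall i, e i g -> forall x, x \in O -> act i x \in O)
  (O_gt0 : O != set0).

(* [T] is the last of the layers successively attached along a walk in the
   complement graph that ends at [r]. Only [r] and the generators in [J], the
   common neighbours of the vertices of the walk, may move points of [T]. *)
Definition tail (J : {set I}) (r : I) := exists (Y : wset e) (f : X -> Y) (T : {set Y}),
  [/\ injective f,
      forall i x, ~~ ((i == g) && (x \in O)) -> act i (f x) = f (act i x),
      forall x, f x \notin T & T != set0] /\
  [/\ forall j, j \in J -> e j r,
      forall i, i != r -> forall y, y \in T -> act i y \in T &
      forall i, i != r -> i \notin J -> forall y, y \in T -> act i y = y].

(** The new copy of [T] is acted on by [r'] and, as on [T], by the neighbours of [r']; of these only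
    the ones in [J] can move its points. *)
Lemma tail_layer (Y : wset e) (r' : I) (J : {set I}) (f : X -> Y) (T : {set Y})
    (Tfix : forall y, y \in T -> act r' y = y)
    (Tstable : forall i, e i r' -> forall y, y \in T -> act i y \in T) :
  injective f ->
  (forall i x, ~~ ((i == g) && (x \in O)) ->
    ~~ ((i == r') && (f x \in T)) /\ act i (f x) = f (act i x)) ->
  T != set0 ->
  (forall i, e i r' -> i \notin J -> forall y, y \in T -> act i y = y) ->
  tail [set j in J | e j r'] r'.
Proof.
move=> f_inj fact T0 Tfix'.
pose Y' := add_layer e_sym e_irr Tfix Tstable.
exists Y', (fun x => inl (f x)), [set inr o | o in [set: {y : Y | y \in T}]]; split; split.
- by move=> x x' [] /f_inj.
- by move=> i x /fact[H E]; rewrite act_layer_inl // E.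
- by move=> x; apply/imsetP => -[].
- by have [y yT] := set0Pn _ T0; apply/set0Pn; exists (inr (Sub y yT)); rewrite imset_f ?inE.
- by move=> j; rewrite inE => /andP[].
- move=> i ir _ /imsetP[o _ ->] /=; rewrite (negPf ir).
  by case: ifP => _; rewrite imset_f ?inE.
- move=> i ir; rewrite inE negb_and => H _ /imsetP[o _ ->].
  apply: act_layer_inr => // eir; apply: Tfix' => //; last exact: valP.
  by move: H; rewrite eir orbF.
Qed.

Lemma tail_start : exists J, tail J g.
Proof.
exists [set j in [set: I] | e j g]; 
apply: (tail_layer (Y := X) (J := [set: I]) (f := id) Ofix Ostable) => //.
by move=> i _; rewrite inE.
Qed.

(** As [r] and [r'] are not adjacent, [r'] is outside [J] and fixes [T] pointwise, while a neighbour
    of [r'] differs from [r] and so preserves [T]. Hence the [r']-loops along [T] can be opened. *)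
Lemma tail_step J r r' : tail J r -> graph_compl e r r' -> tail [set j in J | e j r'] r'.
Proof.
move=> [Y [f [T [[f_inj fact fT T0] [Jr Tst Tfix]]]]] /= /andP[rr' err'].
have Tr' y : y \in T -> act r' y = y.
  apply: Tfix; first by rewrite eq_sym.
  by apply: contraNN err' => /Jr; rewrite e_sym.
have neq_r i : e i r' -> i != r by apply: contraTneq => ->.
apply: (tail_layer (f := f) Tr') => // [i eir'||i eir' iJ].
- exact/Tst/neq_r.
- by move=> i x H; rewrite (negPf (fT x)) andbF fact.
- by apply: Tfix => //; exact: neq_r.
Qed.

Hypothesis e_conn : forall i j, connect (graph_compl e) i j.

(** The set only shrinks along the walk, and at the end it consists of neighbours of [v], hence
    omits [v]. *)
Lemma tail_walk J r v : tail J r -> exists J' : {set I}, [/\ J' \subset J, v \notin J' & tail J' v].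
Proof.
move=> tJ; have /connectP[p pP ->] := e_conn r v.
have last_notin J' r' : tail J' r' -> r' \notin J'.
  by move=> [? [? [? [_ [Jr _ _]]]]]; apply/negP => /Jr; rewrite e_irr.
elim: p r J tJ pP => [|r' p IH] r J tJ /=; first by exists J; split; rewrite ?last_notin.
case/andP => rr' /(IH _ _ (tail_step tJ rr')) [J' [J'J vJ' tJ']].
exists J'; split=> //; apply: subset_trans J'J _.
by apply/subsetP => j; rewrite inE => /andP[].
Qed.

Lemma tail_visit (vs : seq I) : exists (J : {set I}) (r : I),
  [/\ forall v, v \in vs -> v \notin J & tail J r].
Proof.
elim: vs => [|v vs [J [r [vJ tJ]]]]; first by have [J tJ] := tail_start; exists J, g.
have [J' [J'J vJ' tJ']] := tail_walk v tJ.
exists J', v; split=> // w; rewrite inE => /predU1P[->//|/vJ].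
by apply: contraNN; exact: (subsetP J'J).
Qed.

(** After a walk through all vertices [J] is empty; once the walk is continued to [t], its last
    layer is moved by [t] alone. *)
Lemma exists_tail t : exists (Y : wset e) (f : X -> Y) (z : Y),
  [/\ injective f,
      forall i x, ~~ ((i == g) && (x \in O)) -> act i (f x) = f (act i x),
      forall x, f x != z &
      forall i, i != t -> act i z = z].
Proof.
have [J [r [vJ tJ]]] := tail_visit (enum I).
have [J' [J'J vJ' [Y [f [T [[f_inj fact fT T0] [Jr Tst Tfix]]]]]]] := tail_walk t tJ.
have [z zT] := set0Pn _ T0.
exists Y, f, z; split=> // [x|i it]; first by apply: contraNneq (fT x) => ->.
apply: Tfix => //; apply: contra (vJ i _); first exact: (subsetP J'J).
by rewrite mem_enum.
Qed.

End Tail.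

From mathcomp Require Import cyclic center gseries.
From mathcomp Require Import generic_quotient classical_sets cardinality.

(** * Words and homomorphisms *)

Section RacgHom.
Variables (I : finType) (e : rel I).
Local Open Scope group_scope.

Lemma group_closed_inv (G : groupType) (H : set G) x : is_subgroup H -> H x -> H x^-1.
Proof. by move=> /group_closedV Hinv Hx; have := Hinv x; rewrite !inE; apply. Qed.

Lemma group_closed_mul (G : groupType) (H : set G) x y : is_subgroup H -> H x -> H y -> H (x * y).
Proof. by move=> /group_closedM Hmul Hx Hy; have := Hmul x y; rewrite !inE; apply. Qed.

Lemma group_closed_one (G : groupType) (H : set G) : is_subgroup H -> H 1.
Proof. by case; rewrite inE. Qed.

Local Notation pi := (\pi_(presented (racg_relator e)))%qT.

Lemma mult_one (G K : groupType) (f : {multiplicative G -> K}) : f 1 = 1.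
Proof. by apply: (mulgI (f 1)); rewrite -gmulfM !mulg1. Qed.

Lemma mult_inv (G K : groupType) (f : {multiplicative G -> K}) x : f x^-1 = (f x)^-1.
Proof. by apply: (mulgI (f x)); rewrite -gmulfM !mulgV mult_one. Qed.

Lemma mult_exp (G K : groupType) (f : {multiplicative G -> K}) x n :
  f (x ^+ n) = f x ^+ n.
Proof. by elim: n => [|n IH]; rewrite ?mult_one // !expgS gmulfM IH. Qed.

Section Universal.
Variables (Q : groupType) (phi : I -> Q).
Hypotheses (phi2 : forall i, phi i * phi i = 1)
  (phiC : forall i j, e i j -> phi i * phi j = phi j * phi i).

Definition word_eval (w : word I) : Q :=
  foldr (fun l x => (if l.2 then phi l.1 else (phi l.1)^-1) * x) 1 w.

Lemma word_eval_cat u v : word_eval (u ++ v) = word_eval u * word_eval v.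
Proof. by elim: u => [|l u IH] /=; rewrite ?mul1g // IH mulgA. Qed.

Lemma word_eval_pres u v : pres_eq (racg_relator e) u v -> word_eval u = word_eval v.
Proof.
elim=> {u v} //=.
- by move=> u v w _ -> _ ->.
- by move=> u u' v v' _ E _ E'; rewrite !word_eval_cat E E'.
- by move=> i [] /=; rewrite mulg1 ?mulgV ?mulVg.
- move=> r [i|i j eij] /=; first by rewrite mulg1.
  by rewrite mulg1 phiC // (mulgA (phi j)^-1) mulVg mul1g mulVg.
Qed.

Definition racg_lift (x : racg e) : Q := word_eval (repr x).

Lemma racg_lift_pi (w : word I) : racg_lift (pi w) = word_eval w.
Proof. exact/word_eval_pres/pres_repr. Qed.

Lemma racg_liftM : {morph racg_lift : x y / x * y}.
Proof.
move=> x y; by rewrite -word_eval_cat -racg_lift_pi.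
Qed.

Lemma racg_universal : exists f : {multiplicative racg e -> Q}, forall i, f (racg_gen e i) = phi i.
Proof.
pose F := isMultiplicative.Build (racg e) Q racg_lift racg_liftM.
pose f : {multiplicative racg e -> Q} := HB.pack racg_lift F.
by exists f => i; rewrite /= racg_lift_pi /= mulg1.
Qed.

End Universal.

Notation gen := (racg_gen e).

Lemma racg_gen2 i : gen i * gen i = 1.
Proof.
rewrite [_ * _]pres_mul_pi; apply/pres_piP.
exact: (pres_relator (racg_square e i)).
Qed.

Lemma racg_genV i : (gen i)^-1 = gen i.
Proof. by apply: (mulgI (gen i)); rewrite racg_gen2 mulgV. Qed.

Lemma racg_genC i j : e i j -> gen i * gen j = gen j * gen i.
Proof.
move=> eij.
have : (gen i)^-1 * (gen j)^-1 * (gen i * gen j) = 1.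
  have piM u v : (pi u : racg e) * pi v = pi (u ++ v) by exact: pres_mul_pi.
  have piV u : (pi u : racg e)^-1 = pi (winv u) by exact: pres_inv_pi.
  rewrite /racg_gen /pres_gen !piV (piM [:: (i, true)]) (piM (winv _)) piM; apply/pres_piP.
  exact: (pres_relator (racg_commutator eij)).
rewrite !racg_genV => E; apply: (mulIg (gen i * gen j)); rewrite E.
by rewrite -mulgA (mulgA (gen i)) racg_gen2 mul1g racg_gen2.
Qed.

Definition word_prod (w : seq I) : racg e := foldr (fun i x => gen i * x) 1 w.

Lemma word_prod_surj x : exists w, word_prod w = x.
Proof.
rewrite -[x]reprK; elim: (repr x) => [|[i b] w [u uE]]; first by exists [::].
exists (i :: u); rewrite /= uE.
have -> : pi ((i, b) :: w) = (pi [:: (i, b)] : racg e) * pi w by rewrite [RHS]pres_mul_pi.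
congr (_ * _); case: b => //.
have : gen i * (pi [:: (i, false)] : racg e) = 1.
  by rewrite [LHS]pres_mul_pi; apply/pres_piP; exact: (pres_cancel _ i true).
by move=> E; apply: (mulgI (gen i)); rewrite E racg_gen2.
Qed.

End RacgHom.

(** * Finite pieces of Schreier graphs *)

Section Covers.
Variables (I : finType) (e : rel I).
Hypotheses (e_sym : symmetric e) (e_irr : irreflexive e).
Variable H : set (racg e).
Hypothesis Hgrp : is_subgroup H.
Local Open Scope group_scope.
Local Notation gen := (racg_gen e).
Local Notation W := (racg e).

Definition same_coset (x y : W) := H (x * y^-1).
Local Notation "x ~ y" := (same_coset x y) (at level 70).

Lemma same_refl x : x ~ x.
Proof. by rewrite /same_coset mulgV; exact: group_closed_one. Qed.

Lemma same_sym x y : x ~ y -> y ~ x.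
Proof. by move/(group_closed_inv Hgrp); rewrite invgM invgK. Qed.

Lemma same_trans x y z : x ~ y -> y ~ z -> x ~ z.
Proof.
move=> xy yz; have := group_closed_mul Hgrp xy yz.
by rewrite -mulgA (mulgA y^-1) mulVg mul1g.
Qed.

Lemma same_mulr x y z : x * z ~ y * z <-> x ~ y.
Proof. by rewrite /same_coset invgM -mulgA (mulgA z) mulgV mul1g. Qed.

Lemma same_mull h x : H h -> h * x ~ x.
Proof. by rewrite /same_coset mulgK. Qed.

(* A finite piece of the Schreier graph of [H], completed to an action by loops;
   [lab x] represents a coset [H g]. A loop may also be an edge of the Schreier
   graph, which is why the alternative in [lab_act] is not exclusive. *)
Record cover := Cover {
  cover_wset :> wset e;
  lab : cover_wset -> W;
  lab_act : forall i x, act i x = x \/ lab (act i x) ~ lab x * gen i }.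

Definition real (C : cover) i (x : C) := lab (act i x) ~ lab x * gen i.

Fixpoint real_path (C : cover) (x : C) (w : seq I) : Prop :=
  if w is i :: w' then real i x /\ real_path (act i x) w' else True.

Definition acts (X : wset e) (x : X) (w : seq I) := foldl (fun y i => act i y) x w.

Lemma lab_acts (C : cover) (x : C) w : real_path x w ->
  lab (acts x w) ~ lab x * word_prod e w.
Proof.
elim: w x => [|i w IH] x /=; first by rewrite mulg1 => _; exact: same_refl.
by case=> xi /IH /same_trans; apply; rewrite mulgA same_mulr.
Qed.

(** Only real edges have to be preserved, because the other loops may be opened up in the target. *)
Definition cover_map (C C' : cover) (f : C -> C') :=
  [/\ injective f, forall i x, real i x -> act i (f x) = f (act i x) &
      forall x, lab (f x) = lab x].

Lemma cover_map_id (C : cover) : cover_map (@id C).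
Proof. by split. Qed.

Lemma cover_map_comp (C C' C'' : cover) (f : C -> C') (f' : C' -> C'') :
  cover_map f -> cover_map f' -> cover_map (f' \o f).
Proof.
case=> fI fA fL [f'I f'A f'L]; split; first exact: inj_comp.
- by move=> i x xi /=; rewrite f'A ?fA // /real fA // !fL.
- by move=> x; rewrite /= f'L.
Qed.

Lemma cover_map_real (C C' : cover) (f : C -> C') i x :
  cover_map f -> real i x -> real i (f x).
Proof. by case=> _ fA fL xi; rewrite /real fA // !fL. Qed.

Lemma cover_map_path (C C' : cover) (f : C -> C') x w :
  cover_map f -> real_path x w -> real_path (f x) w /\ acts (f x) w = f (acts x w).
Proof.
move=> fC; have [_ fA _] := fC; elim: w x => [|i w IH] x //= [xi /IH[]].
by rewrite fA // => ? ?; do 2?split => //; exact: cover_map_real.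
Qed.

Section Thicken.
Variables (C : cover) (g : I).

Definition unreal : {set C} := [set x | ~~ `[< real g x >]].

Lemma unrealP x : reflect (~ real g x) (x \in unreal).
Proof. by rewrite inE; exact: (iffP (asboolPn _)). Qed.

Lemma unreal_fix x : x \in unreal -> act g x = x.
Proof. by move/unrealP; case: (lab_act g x). Qed.

(** A real [g]-edge at [act i x] would be carried back to one at [x], since [i] and [g] commute. *)
Lemma unreal_stable i : e i g -> forall x, x \in unreal -> act i x \in unreal.
Proof.
move=> eig x xU; have gx := unreal_fix xU; move/unrealP: xU => xU; apply/unrealP => rgix; apply: xU.
have [ix|ix] := lab_act i x; first by rewrite ix in rgix.
move: rgix; rewrite /real -(actC eig) gx => rgix.
rewrite -(same_mulr _ _ (gen i)) -mulgA -racg_genC // mulgA.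
apply: (same_trans (same_sym ix)); apply: (same_trans rgix).
by rewrite same_mulr.
Qed.

Definition thick_wset := add_layer e_sym e_irr unreal_fix unreal_stable.

Definition thick_lab (u : thick_wset) : W :=
  match u with inl x => lab x | inr o => lab (val o) * gen g end.

Lemma thick_lab_act i u : act i u = u \/ thick_lab (act i u) ~ thick_lab u * gen i.
Proof.
case: u => [x|o].
  have [/andP[/eqP-> xU]|nU] := boolP ((i == g) && (x \in unreal)).
    by rewrite act_layer_inlO; right; exact: same_refl.
  by rewrite act_layer_inl //=; case: (lab_act i x) => [->|]; [left|right].
have [->|ig] := eqVneq i g.
  rewrite act_layer_inrg; right => /=.
  by rewrite -mulgA racg_gen2 mulg1; exact: same_refl.
have oU := valP o; have [io|io] := lab_act i (val o).
  by left; apply: act_layer_inr.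
rewrite /= (negPf ig); case: ifPn => eig; last by left.
right; rewrite /= val_insubd unreal_stable //.
by rewrite -mulgA -racg_genC // mulgA same_mulr.
Qed.

Definition thicken := Cover thick_lab_act.

Lemma thicken_map : cover_map (inl : C -> thicken).
Proof.
split=> [x y []//|i x xi|//].
by rewrite act_layer_inl // negb_and; case: eqP => //= E; apply/unrealP; rewrite -E.
Qed.

Lemma thicken_real x : real g (inl x : thicken).
Proof.
have [xU|xU] := boolP (x \in unreal).
  by rewrite /real act_layer_inlO; exact: same_refl.
apply: (cover_map_real thicken_map).
by move: xU; rewrite inE negbK => /asboolP.
Qed.

End Thicken.

Lemma thicken_word w (C : cover) (x : C) :
  exists (C' : cover) (f : C -> C'), cover_map f /\ real_path (f x) w.
Proof.
elim: w C x => [|i w IH] C x; first by exists C, id; split; first exact: cover_map_id.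
have [C' [f [fC fw]]] := IH (thicken C i) (act i (inl x : thicken C i)).
exists C', (f \o (inl : C -> thicken C i)); split; first exact: (cover_map_comp (@thicken_map C i) fC).
have r := thicken_real i x; split; first exact: (cover_map_real fC).
by have [_ fA _] := fC; rewrite /= fA.
Qed.

Lemma thicken_words (ws : seq (seq I)) (C : cover) (x : C) :
  exists (C' : cover) (f : C -> C'), cover_map f /\ (forall w, w \in ws -> real_path (f x) w).
Proof.
elim: ws C x => [|w ws IH] C x; first by exists C, id; split; first exact: cover_map_id.
have [C1 [f1 [f1C f1w]]] := thicken_word w x.
have [C2 [f2 [f2C f2w]]] := IH C1 (f1 x).
exists C2, (f2 \o f1); split; first exact: cover_map_comp.
by move=> w'; rewrite inE => /predU1P[->|/f2w//]; case: (cover_map_path f2C f1w).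
Qed.

(** If all edges were real, every coset would be labelled by one of the finitely many points. *)
Lemma infinite_index_unreal (C : cover) (x0 : C) : infinite_index H ->
  exists (g : I) (x : C), ~ real g x.
Proof.
move=> Hinf; apply: contrapT => allreal; apply: Hinf.
have rl g (x : C) : real g x by apply: contrapT => nr; apply: allreal; exists g, x.
have rp w : forall x : C, real_path x w by elim: w => [|i w IH] x //=.
(* Labels stand for right cosets while the index counts left ones, whence the inverse. *)
apply: (@sub_finite_set _ _ [set ltranslate (lab x)^-1 H | x in [set: C]]).
  move=> _ [y _ <-].
  have [w wE] := word_prod_surj ((lab x0)^-1 * y^-1).
  have := lab_acts (rp w x0); rewrite wE mulgA mulgV mul1g.
  rewrite /same_coset invgK => Hy; exists (acts x0 w) => //.
  rewrite eqEsubset; split=> _ [h Hh <-].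
    exists (y^-1 * (lab (acts x0 w))^-1 * h); last by rewrite !mulgA mulgV mul1g.
    by apply: group_closed_mul => //; rewrite -invgM; exact: group_closed_inv.
  exists (lab (acts x0 w) * y * h); last by rewrite !mulgA mulVg mul1g.
  exact: group_closed_mul.
exact/finite_image/finite_finset.
Qed.

End Covers.

(** * The finite cover carried by an invariant convex set of vertices *)

Section BaseCover.
Variables (I : finType) (e : rel I).
Hypotheses (e_sym : symmetric e) (e_irr : irreflexive e).
Variable H : set (racg e).
Hypothesis Hgrp : is_subgroup H.
Local Open Scope group_scope.
Local Notation gen := (racg_gen e).
Local Notation W := (racg e).
Local Notation "x ~ y" := (same_coset H x y) (at level 70).

Fixpoint path_in (V : set W) (v : W) (w : seq I) : Prop :=
  if w is i :: w' then V (v * gen i) /\ path_in V (v * gen i) w' else True.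

Variables (V : set W) (reps : seq W) (v0 : W).
Hypotheses (V0 : V v0)
  (Vinv : forall h v, H h -> V v -> V (h * v))
  (Vcorner : forall i j v, e i j -> V v -> V (v * gen i) -> V (v * gen j) ->
    V (v * gen i * gen j))
  (Vconn : forall v v', V v -> V v' -> exists w, path_in V v w /\ v * word_prod e w = v')
  (Vreps : forall v, V v -> exists2 r, r \in reps & v ~ r).

(* Edges leaving [V] become loops; the corner condition is what keeps the actions
   of adjacent generators commuting. *)
Definition loop_act i (v : W) : W := if `[< V (v * gen i) >] then v * gen i else v.

Lemma loop_actV i v : V v -> V (loop_act i v).
Proof. by rewrite /loop_act; case: asboolP. Qed.

Lemma loop_actK i v : V v -> loop_act i (loop_act i v) = v.
Proof.
move=> Vv; rewrite /loop_act; case: (asboolP (V (v * gen i))) => [Vi|nVi].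
  by rewrite -mulgA racg_gen2 mulg1; case: asboolP.
by case: asboolP.
Qed.

Lemma loop_actC i j v : e i j -> V v -> loop_act i (loop_act j v) = loop_act j (loop_act i v).
Proof.
move=> eij Vv; have gC : v * gen i * gen j = v * gen j * gen i by rewrite -!mulgA racg_genC.
have eji : e j i by rewrite e_sym.
have genK k : v * gen k * gen k = v by rewrite -mulgA racg_gen2 mulg1.
have Vout k l : e k l -> V (v * gen k) -> ~ V (v * gen l) -> ~ V (v * gen k * gen l).
  move=> ekl Vk nVl Vkl; apply: nVl.
  have := Vcorner ekl Vk _ Vkl; rewrite genK => /(_ Vv).
  by rewrite (_ : v * gen l = v * gen k * gen k * gen l) // genK.
rewrite /loop_act; case: (asboolP (V (v * gen i))) => Vi; case: (asboolP (V (v * gen j))) => Vj.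
- by rewrite -gC !ifT //; apply/asboolP; [exact: Vcorner | exact: Vcorner].
- by rewrite asboolT // asboolF //; exact: Vout.
- by rewrite asboolF //; exact: Vout.
- by rewrite asboolF.
Qed.

Lemma loop_act_same i v v' : V v -> v ~ v' -> loop_act i v ~ loop_act i v'.
Proof.
move=> Vv vv'; have VE : V (v * gen i) <-> V (v' * gen i).
  have vv'i : v * gen i ~ v' * gen i by rewrite same_mulr.
  split=> [Vi|Vi].
    have := Vinv (same_sym Hgrp vv'i) Vi; by rewrite mulgKV.
  by have := Vinv vv'i Vi; rewrite mulgKV.
rewrite /loop_act; case: asboolP => [/VE|] vi; case: asboolP => // vi'.
  by rewrite same_mulr.
by case: vi; apply/VE.
Qed.

(** A chosen element of the coset of [v] names the corresponding point of the quotient; the default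
    [1] is never reached, as [v] itself is a candidate. *)
Definition coset_rep (v : W) : W := xget 1 [set x | x ~ v].

Lemma coset_repE v : coset_rep v ~ v.
Proof. by rewrite /coset_rep; case: xgetP => [x _ //|/(_ v)[]]; exact: same_refl. Qed.

Lemma coset_rep_eq v v' : v ~ v' -> coset_rep v = coset_rep v'.
Proof.
move=> vv'; rewrite /coset_rep; congr xget; apply/seteqP; split=> x /= xv.
  exact: same_trans xv vv'.
exact: same_trans xv (same_sym Hgrp vv').
Qed.

Lemma coset_rep_in v v' : V v -> v' ~ v -> V v'.
Proof. by move=> Vv /Vinv/(_ Vv); rewrite mulgKV. Qed.

Definition base_seq : seq W := [seq coset_rep r | r <- reps & `[< V r >]].
Definition base_pt : finType := seq_sub base_seq.

Lemma base_seqP v : V v -> coset_rep v \in base_seq.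
Proof.
move=> Vv; have [r rr vr] := Vreps Vv; rewrite (coset_rep_eq vr).
apply: map_f; rewrite mem_filter rr andbT; apply/asboolP.
exact: coset_rep_in Vv (same_sym Hgrp vr).
Qed.

Lemma base_ptP (x : base_pt) : V (val x) /\ coset_rep (val x) = val x.
Proof.
case: x => x /= /mapP[r]; rewrite mem_filter => /andP[/asboolP Vr _] ->.
by split; [exact: coset_rep_in Vr (coset_repE r) | apply: coset_rep_eq; exact: coset_repE].
Qed.

Definition base_of (v : W) (Vv : V v) : base_pt := Sub (coset_rep v) (base_seqP Vv).

Definition base_act i (x : base_pt) : base_pt :=
  base_of (loop_actV i (proj1 (base_ptP x))).

Lemma val_base_act i x v : V v -> val x = coset_rep v ->
  val (base_act i x) = coset_rep (loop_act i v).
Proof.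
move=> Vv xv; apply: coset_rep_eq; apply: loop_act_same; first exact: (base_ptP x).1.
by rewrite xv; exact: coset_repE.
Qed.

Lemma base_actK i : involutive (base_act i).
Proof.
move=> x; apply: val_inj; have [Vx xE] := base_ptP x.
by rewrite (@val_base_act i _ (loop_act i (val x))) ?loop_actK //; exact: loop_actV.
Qed.

Lemma base_actC i j : e i j -> forall x, base_act i (base_act j x) = base_act j (base_act i x).
Proof.
move=> eij x; apply: val_inj; have [Vx xE] := base_ptP x.
rewrite (@val_base_act i _ (loop_act j (val x))) //; last exact: loop_actV.
by rewrite (@val_base_act j _ (loop_act i (val x))) ?(loop_actC eij) //; exact: loop_actV.
Qed.

Lemma path_in_trans (P : base_pt -> Prop) : (forall i x, P x -> P (base_act i x)) ->
  forall w v x y, V v -> path_in V v w -> val x = coset_rep v ->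
    val y = coset_rep (v * word_prod e w) -> P x -> P y.
Proof.
move=> Pact; elim=> [|i w IH] v x y Vv /=.
  by rewrite mulg1 => _ xv yv; have -> : x = y by apply: val_inj; exact: etrans xv (esym yv).
case=> Vi wV xv yv Px; apply: (IH (v * gen i) (base_act i x)) => //; last exact: Pact.
  by rewrite (val_base_act _ Vv xv) /loop_act asboolT.
by move: yv; rewrite mulgA.
Qed.

Lemma base_trans (P : base_pt -> Prop) : (forall i x, P x -> P (base_act i x)) ->
  forall x y, P x -> P y.
Proof.
move=> Pact x y; have [Vx xE] := base_ptP x; have [Vy yE] := base_ptP y.
have [w [wV wE]] := Vconn Vx Vy.
by apply: (path_in_trans Pact Vx wV); rewrite ?xE // wE yE.
Qed.

Definition base_wset := Wset base_actK base_actC base_trans.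

Lemma base_lab_act i (x : base_wset) :
  act i x = x \/ val (act i x) ~ val x * gen i.
Proof.
have [Vx xE] := base_ptP x.
have := val_base_act i Vx (esym xE); rewrite /loop_act; case: asboolP => Vi aE.
  by right; move: (coset_repE (val x * gen i)); rewrite -aE.
by left; apply: val_inj; exact: etrans aE xE.
Qed.

Definition base_cover : cover H := Cover base_lab_act.

Lemma base_cover_path w v (x : base_cover) : V v -> path_in V v w -> val x = coset_rep v ->
  real_path x w /\ val (acts x w) = coset_rep (v * word_prod e w).
Proof.
elim: w v x => [|i w IH] v x Vv /=; first by rewrite mulg1.
case=> Vi wV xv.
have aE : val (base_act i x) = coset_rep (v * gen i).
  by rewrite (val_base_act i Vv xv) /loop_act asboolT.
have [xw ->] := IH _ (base_act i x) Vi wV aE.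
split; last by rewrite mulgA.
split=> //; rewrite /real /= [X in X ~ _]aE xv.
apply: same_trans (coset_repE _) _ => //.
by rewrite same_mulr; apply: same_sym => //; exact: coset_repE.
Qed.

(** A path inside [V] from a vertex to its translate by [h] has only real edges and closes up in the
    quotient by [H]. *)
Lemma exists_base_cover : exists (C : cover H) (x : C),
  forall h, H h -> exists w,
    [/\ real_path x w, acts x w = x & word_prod e w = (lab x)^-1 * h * lab x].
Proof.
pose x0 : base_cover := base_of V0.
exists base_cover, x0 => h Hh; have [Vx xE] := base_ptP x0.
have [w [wV wE]] := Vconn Vx (Vinv Hh Vx).
have [xw aE] := base_cover_path Vx wV (esym xE).
exists w; split=> //.
  by apply: val_inj; rewrite aE wE -[RHS]xE; apply: coset_rep_eq; exact: same_mull.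
by rewrite -mulgA /= -wE mulgA mulVg mul1g.
Qed.

End BaseCover.

(** * The Davis-Moussong complex *)

Section DavisMoussong.
Variables (I : finType) (e : rel I).
Hypotheses (e_sym : symmetric e) (e_irr : irreflexive e).
Local Open Scope group_scope.
Local Open Scope classical_set_scope.
Local Notation gen := (racg_gen e).
Local Notation W := (racg e).

(** A sign character that detects one generator; it shows that the generators are nontrivial and
    distinct. *)
Lemma gen_indicator i : exists f : {multiplicative W -> {perm bool}},
  forall k, f (gen k) = if k == i then tperm true false else 1.
Proof.
by apply: racg_universal => [k|k l _]; case: (k == i); rewrite ?tperm2 ?mulg1 //;
  case: (l == i); rewrite ?mulg1 ?mul1g.
Qed.

Lemma tperm_bool_neq1 : tperm true false <> 1 :> {perm bool}.
Proof. by move=> /permP/(_ true); rewrite tpermL perm1. Qed.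

Lemma gen_neq1 i : gen i <> 1.
Proof.
have [f fE] := gen_indicator i => E; apply: tperm_bool_neq1.
by have := congr1 f E; rewrite fE eqxx mult_one.
Qed.

Lemma gen_inj : injective gen.
Proof.
move=> i j E; have [f fE] := gen_indicator i; apply/eqP; apply: contrapT => ij.
by apply: tperm_bool_neq1; have := fE j; rewrite -E fE eqxx ifN // eq_sym; apply/negP.
Qed.

Lemma gen_mul_neq_gen i j k : i != j -> gen i * gen k <> gen j.
Proof.
move=> ij E; have [f fE] := gen_indicator j.
have := congr1 f E; rewrite gmulfM !fE eqxx (negPf ij) mul1g.
case: eqP => [kj _|_ /esym/tperm_bool_neq1//].
by apply: (@gen_neq1 i); apply: (mulIg (gen j)); rewrite -{1}kj E mul1g.
Qed.

Lemma mul_gen_neq v i : v <> v * gen i.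
Proof. by move=> E; apply: (@gen_neq1 i); apply: (mulgI v); rewrite -E mulg1. Qed.

Lemma DM_vertex v : DM e [set v].
Proof.
exists v, finset.set0; split=> [i j|]; first by rewrite inE.
apply/seteqP; split=> [_ -> /=|_ [Q /= + <-] /=].
  by exists finset.set0; [exact: finset.sub0set | rewrite big_set0 mulg1].
by rewrite finset.subset0 => /eqP->; rewrite big_set0 mulg1.
Qed.

Lemma DM_edge v i : DM e [set v; v * gen i].
Proof.
exists v, (finset.set1 i); split=> [j k|].
  by move=> /finset.set1P-> /finset.set1P->.
apply/seteqP; split=> [x /= [] ->|_ [Q /= + <-] /=].
- by exists finset.set0; [exact: finset.sub0set | rewrite big_set0 mulg1].
- by exists (finset.set1 i); [exact: subxx | rewrite big_set1].
rewrite finset.subset1 => /orP[] /eqP->; first by rewrite big_set1; right.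
by rewrite big_set0 mulg1; left.
Qed.

Lemma DM_adj u v : skel_adj (DM e) u v <-> exists i, v = u * gen i.
Proof.
split=> [/asboolP[uv [g [P [_ E]]]]|[i ->]]; last first.
  by apply/asboolP; split; [exact: mul_gen_neq | exact: DM_edge].
have [P0|[i iP]] := set_0Vmem P.
  have sub x : [set u; v] x -> x = g.
    by rewrite E => -[Q /=]; rewrite P0 finset.subset0 => /eqP-> <-; rewrite big_set0 mulg1.
  by case: uv; rewrite (sub u (or_introl erefl)) (sub v (or_intror erefl)).
have gE : [set u; v] g.
  by rewrite E; exists finset.set0; [exact: finset.sub0set | rewrite big_set0 mulg1].
have giE : [set u; v] (g * gen i).
  by rewrite E; exists (finset.set1 i); [rewrite /= finset.sub1set | rewrite big_set1].
exists i; case: gE giE => -> [] //.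
- by move/esym/mul_gen_neq.
- by move=> <-; rewrite -mulgA racg_gen2 mulg1.
- by move/esym/mul_gen_neq.
Qed.

Variable Y : set (set W).
Hypothesis Yconv : convex_subcomplex (DM e) Y.

Lemma vertex_of_cube c x : Y c -> c x -> Y [set x].
Proof.
case: Yconv => -[_ Ysub] _ Yc cx; apply: (Ysub c) => //; first exact: DM_vertex.
by move=> _ ->.
Qed.

Lemma geodesic_in_Y u p : Y [set u] -> Y [set last u p] ->
  path (skel_adj (DM e)) u p ->
  (forall q, path (skel_adj (DM e)) u q -> last u q = last u p -> size p <= size q) ->
  path (skel_adj Y) u p.
Proof. by move=> Yu Yl pp pmin; apply: Yconv.2. Qed.

(** The vertices [v * gen i] and [v * gen j] are at distance two, so the path between them through
    the fourth corner is a geodesic and lies in [Y]. *)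
Lemma Y_corner i j v : e i j -> Y [set v] -> Y [set v * gen i] -> Y [set v * gen j] ->
  Y [set v * gen i * gen j].
Proof.
move=> eij _ Yi Yj; have ij : i != j by apply: contraTneq eij => ->; rewrite e_irr.
have gC : v * gen i * gen j = v * gen j * gen i by rewrite -!mulgA racg_genC.
have : path (skel_adj Y) (v * gen i) [:: v * gen i * gen j; v * gen j].
  apply: geodesic_in_Y => //.
    rewrite /= andbT; apply/andP; split; apply/DM_adj; first by exists j.
    by exists i; rewrite gC -mulgA racg_gen2 mulg1.
  move=> [|x [|]] //=.
    by move=> _ /mulgI/gen_inj E; rewrite E eqxx in ij.
  rewrite andbT => /DM_adj[k ->] E.
  by case: (@gen_mul_neq_gen i j k ij); apply: (mulgI v); rewrite mulgA.
by move=> /= /andP[/asboolP[_ Yc] _]; apply: vertex_of_cube Yc _; right.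
Qed.

Lemma skel_path_word u w : exists p, path (skel_adj (DM e)) u p /\ last u p = u * word_prod e w.
Proof.
elim: w u => [|i w IH] u; first by exists [::]; rewrite /= mulg1.
have [p [pp pE]] := IH (u * gen i); exists (u * gen i :: p) => /=; split.
  by rewrite pp andbT; apply/DM_adj; exists i.
by rewrite pE mulgA.
Qed.

Lemma Y_path_word u p : path (skel_adj Y) u p ->
  exists w, path_in [set v | Y [set v]] u w /\ u * word_prod e w = last u p.
Proof.
elim: p u => [|x p IH] u /=; first by exists [::]; rewrite /= mulg1.
case/andP => /asboolP[ux Yux] /IH[w [wV wE]].
have [i xE] : exists i, x = u * gen i.
  by apply/DM_adj/asboolP; split=> //; case: Yconv => -[YX _] _; exact: YX.
exists (i :: w); rewrite /= -xE; split; last by rewrite mulgA -xE.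
by split=> //; apply: vertex_of_cube Yux _; right.
Qed.

(** By convexity a shortest path of the whole complex stays in [Y]. *)
Lemma Y_connected u v : Y [set u] -> Y [set v] ->
  exists w, path_in [set v | Y [set v]] u w /\ u * word_prod e w = v.
Proof.
move=> Yu Yv.
pose D n := `[< exists p, [/\ path (skel_adj (DM e)) u p, last u p = v & size p = n] >].
have exD : exists n, D n.
  have [w wE] := word_prod_surj (u^-1 * v); have [p [pp pE]] := skel_path_word u w.
  by exists (size p); apply/asboolP; exists p; split; rewrite // pE wE mulgA mulgV mul1g.
case: (ex_minnP exD) => n Dn pmin; move/asboolP: Dn => [p [pp pE pn]].
rewrite -pE; apply: Y_path_word; apply: geodesic_in_Y; rewrite ?pE //.
by move=> q qp qE; rewrite pn; apply: pmin; apply/asboolP; exists q.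
Qed.

Variable H : set W.
Hypotheses (Yinv : invariant_under H Y) (Ycoc : cocompact_on H Y).

Lemma Y_inv h v : H h -> Y [set v] -> Y [set h * v].
Proof. by move=> Hh /(Yinv Hh); rewrite /ltranslate image_set1. Qed.

Lemma Y_reps : exists reps : seq W, forall v, Y [set v] -> exists2 r, r \in reps & same_coset H v r.
Proof.
case: Ycoc => K [Kfin KY Kall].
(* One vertex is picked in each cube of [K]. A cube with translate [[set v]] has a single vertex, so
   the pick is the right one there. *)
have := finite_image (fun k : set W => xget 1 k) Kfin.
case/finite_seqP => reps repsE; exists reps => v /Kall [h [k [Hh Kk E]]].
have [x kx hx] : [set h * x | x in k] v by rewrite -[[set h * x | x in k]]/(ltranslate h k) -E.
have kE y : k y -> h * y = v.
  by move=> ky; have : ltranslate h k (h * y) by [exists y]; rewrite -E.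
exists (xget 1 k).
  by have : [set` reps] (xget 1 k) by rewrite -repsE; exists k.
by rewrite /same_coset -(kE _ (xgetPex 1 (ex_intro _ x kx))) mulgK.
Qed.

End DavisMoussong.

(** * Separation when the complement graph is connected *)

Section PermTransport.
Variable X : finType.
Local Open Scope group_scope.
Implicit Types p q : {perm X}.

Lemma perm_ord_inj p : injective (fun k : 'I_#|X| => enum_rank (p (enum_val k))).
Proof. by move=> k l /enum_rank_inj/perm_inj/enum_val_inj. Qed.

Definition perm_ord p : {perm 'I_#|X|} := perm (@perm_ord_inj p).

Lemma perm_ordM : {morph perm_ord : p q / p * q}.
Proof. by move=> p q; apply/permP => k; rewrite [RHS]permM ![perm_ord _ _]permE permM enum_rankK. Qed.

Lemma perm_ord_injective : injective perm_ord.
Proof.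
move=> p q pq; apply/permP => x; have := congr1 (fun r : {perm _} => r (enum_rank x)) pq.
by rewrite !permE !enum_rankK => /enum_rank_inj.
Qed.

Lemma perm_ord_surj (r : {perm 'I_#|X|}) : exists p, perm_ord p = r.
Proof.
have inj_r : injective (fun x => enum_val (r (enum_rank x))).
  by move=> x y /enum_val_inj/perm_inj/enum_rank_inj.
by exists (perm inj_r); apply/permP => k; rewrite !permE enum_valK enum_valK.
Qed.

Lemma odd_perm_ord p : odd_perm (perm_ord p) = odd_perm p.
Proof.
have [ts -> _] := prod_tpermP p.
elim: ts => [|t ts IH].
  rewrite big_nil odd_perm1; apply: (@addbI (odd_perm (perm_ord 1))).
  by rewrite -odd_permM -perm_ordM mulg1 addbF.
rewrite big_cons perm_ordM !odd_permM IH; congr addb.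
have -> : perm_ord (tperm t.1 t.2) = tperm (enum_rank t.1) (enum_rank t.2).
  apply/permP => k; rewrite permE -{2}(enum_valK k).
  by rewrite -(inj_tperm _ _ _ (@enum_rank_inj X)).
by rewrite !odd_tperm (inj_eq (@enum_rank_inj X)).
Qed.

End PermTransport.

Section Separation.
Variables (I : finType) (e : rel I).
Hypotheses (e_sym : symmetric e) (e_irr : irreflexive e).
Local Open Scope group_scope.
Local Open Scope classical_set_scope.
Local Notation gen := (racg_gen e).
Local Notation W := (racg e).

Lemma wset_hom (X : wset e) : exists rho : {multiplicative W -> {perm X}},
  (forall i, rho (gen i) = wperm X i) /\
  forall w x, rho (word_prod e w) x = acts x w.
Proof.
have [||rho rhoE] := @racg_universal I e {perm X} (wperm X).
- by move=> i; apply/permP => x; rewrite permM !permE actK.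
- by move=> i j eij; apply/permP => x; rewrite !permM !permE (actC eij).
exists rho; split=> //; elim=> [|i w IH] x; first by rewrite mult_one perm1.
by rewrite /= gmulfM permM IH rhoE permE.
Qed.

Lemma gens_sub_range (X : wset e) (rho : {multiplicative W -> {perm X}}) :
  (forall i, rho (gen i) = wperm X i) ->
  forall p, p \in <<gens X>> -> exists x, rho x = p.
Proof.
move=> rhoE p /gen_prodgP[n [c cG ->]].
apply: (big_ind (fun p => exists x, rho x = p)); first by exists 1; rewrite mult_one.
  by move=> _ _ [x <-] [y <-]; exists (x * y); rewrite gmulfM.
by move=> k _; have /imsetP[i _ ->] := cG k; exists (gen i).
Qed.

(** On a walk of the complement graph from [a] to an [e]-neighbour [b], the first vertex adjacent to
    [a] in [e] serves as [u], its predecessor as [t], and [a] as [s]. *)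
Lemma exists_compl_path : ~ discrete_graph e -> (forall i j, connect (graph_compl e) i j) ->
  exists s t u, [/\ e s u, ~~ e s t, ~~ e t u, s != t & t != u].
Proof.
move=> nondisc conn; apply: contrapT => nP; apply: nondisc => a b; apply/negP => eab.
have step x y : x = a \/ (x != a /\ ~~ e a x) -> graph_compl e x y -> y = a \/ (y != a /\ ~~ e a y).
  move=> [->|[xa eax]] /= /andP[xy exy]; first by right; rewrite eq_sym.
  have [->|ya] := eqVneq y a; [by left|right; split=> //].
  by apply/negP => eay; apply: nP; exists a, x, y; split; rewrite // eq_sym.
have /connectP[p pP bE] := conn a b.
suff [ba|[_ /negP//]] : b = a \/ (b != a /\ ~~ e a b) by rewrite ba e_irr in eab.
have walk q : forall x, path (graph_compl e) x q -> x = a \/ (x != a /\ ~~ e a x) ->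
    last x q = a \/ (last x q != a /\ ~~ e a (last x q)).
  elim: q => [|y q IH] x //=; case/andP=> xy yq xP.
  by apply: IH => //; exact: step xP xy.
by rewrite bE; apply: walk => //; left.
Qed.

Variable H : set W.
Hypotheses (e_nondiscrete : ~ discrete_graph e)
  (e_conn : forall i j, connect (graph_compl e) i j)
  (Hgrp : is_subgroup H) (Hinf : infinite_index H) (Hcc : convex_cocompact H).

(** The point [y0] carries the label [v]. Applying [v^-1] and [v^-1 * x] to it gives the same point
    when [x] is in [H]; when [x] is in [F], it gives points over the distinct cosets of [1] and [x].
    Hence [x] and an element of [H] never have the same image. *)
Lemma separating_wset (even : bool) (F : set W) : finite_set F -> F `<=` ~` H ->
  exists (X : wset e) (rho : {multiplicative W -> {perm X}}),
  [/\ forall i, rho (gen i) = wperm X i,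
      forall x h, F x -> H h -> rho x <> rho h,
      ('Alt_X \subset <<gens X>>)%g &
      if even then forall i, ~~ odd_perm (wperm X i)
      else exists i, odd_perm (wperm X i)].
Proof.
move=> /finite_seqP[Fs FE] FH; have [Y [Y0 Yconv Yinv Ycoc]] := Hcc.
pose V : set W := [set v | Y [set v]].
have [v0 Vv0] : exists v0, V v0.
  have [c Yc] := Y0; have [g [P [_ cE]]] := Yconv.1.1 _ Yc.
  exists g; apply: (vertex_of_cube Yconv Yc); rewrite cE.
  by exists finset.set0; [exact: finset.sub0set | rewrite big_set0 mulg1].
have [reps Vreps] := Y_reps Ycoc.
have [C [x0 x0H]] := exists_base_cover e_sym Hgrp Vv0 (@Y_inv _ _ _ _ Yinv)
  (fun i j v eij => Y_corner e_irr Yconv eij) (@Y_connected _ _ _ Yconv) Vreps.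
pose v := lab x0.
have [wd wdE] := choice (@word_prod_surj I e).
have [C1 [f1 [f1C f1w]]] := thicken_words e_sym e_irr Hgrp (wd v^-1 :: [seq wd (v^-1 * x) | x <- Fs]) x0.
have [g [x1 x1g]] := infinite_index_unreal Hgrp (f1 x0) Hinf.
have O0 : unreal C1 g != finset.set0 by apply/finset.set0Pn; exists x1; apply/unrealP.
have [s [t [u [esu est etu st tu]]]] := exists_compl_path e_nondiscrete e_conn.
have [Y2 [f2 [z [f2I f2A f2z zfix]]]] := exists_tail e_sym e_irr (@unreal_fix _ _ _ C1 g)
  (@unreal_stable _ _ _ Hgrp C1 g) O0 e_conn t.
have [X [f3 [f3I f3A XAlt Xodd]]] := alternating_extension e_sym e_irr esu est etu st tu even zfix.
have [rho [rhoE rhoA]] := wset_hom X.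
exists X, rho; split=> //.
pose f := f3 \o f2; have fI : injective f by exact: inj_comp.
(* Real edges survive both extensions: [f2] alters the action only at unreal [g]-loops, and [f3]
   only at [z], which [f2] misses. *)
have fA (x : C1) w : real_path x w -> acts (f x) w = f (acts x w).
  elim: w x => [|i w IH] x //= [xi /IH <-]; rewrite /f /= f3A ?f2A //.
  by apply/negP => /andP[/eqP E /unrealP]; rewrite -E.
pose y0 := f (f1 x0).
have labf : lab (f1 x0) = v by case: f1C.
have o_move x : H x -> rho (v^-1 * x) y0 = rho v^-1 y0.
  move=> Hx; have [w [xw ax wE]] := x0H _ Hx.
  have [xw' ax'] := cover_map_path f1C xw.
  have E0 : rho (v^-1 * x * v) y0 = y0.
    by rewrite -wE rhoA /y0 fA // ax' ax.
  by rewrite -{2}E0 -permM -gmulfM mulgK.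
move=> x h Fx Hh E.
have xFs : x \in Fs by have : [set` Fs] x by rewrite -FE.
have : rho (v^-1 * x) y0 = rho v^-1 y0.
  by rewrite -(o_move _ Hh) !gmulfM E.
have w0 : real_path (f1 x0) (wd v^-1) by apply: f1w; rewrite inE eqxx.
have wx : real_path (f1 x0) (wd (v^-1 * x)) by apply: f1w; rewrite inE map_f ?orbT.
have := rhoA (wd v^-1) y0; have := rhoA (wd (v^-1 * x)) y0.
rewrite !wdE /y0 !fA // => -> -> /fI aE.
have := lab_acts Hgrp wx; have := lab_acts Hgrp w0.
rewrite aE !wdE labf mulgV mulgA mulgV mul1g => L0 Lx.
have := same_trans Hgrp (same_sym Hgrp L0) Lx.
rewrite /same_coset mul1g => /(group_closed_inv Hgrp); rewrite invgK.
exact: FH.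
Qed.

Lemma separable_alternating : separable alternating_groups H.
Proof.
move=> F Ffin FH.
have [X [rho [rhoE rhoF XAlt Xeven]]] := separating_wset true Ffin FH.
have rho_even x : ~~ odd_perm (rho x).
  have [w <-] := word_prod_surj x; elim: w => [|i w IH]; first by rewrite mult_one odd_perm1.
  by rewrite /= gmulfM odd_permM rhoE (negPf (Xeven i)).
pose Q : groupType := [subg 'Alt_('I_#|X|)]%type.
pose f x : Q := subg _ (perm_ord (rho x)).
have fE x : sgval (f x) = perm_ord (rho x).
  by rewrite subgK // Alt_even odd_perm_ord.
have fM : {morph f : x y / x * y}.
  by move=> x y; apply: val_inj; rewrite /= !fE gmulfM perm_ordM.
pose fB := isMultiplicative.Build W Q f fM.
pose fm : {multiplicative W -> Q} := HB.pack f fB.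
exists Q, fm; split.
- exists #|X|; exists idfun; by exists idfun.
- apply/seteqP; split=> // q _; have [p pE] := perm_ord_surj (sgval q).
  have /(gens_sub_range rhoE)[x xE] : (p \in <<gens X>>)%g.
    apply: (fintype.subsetP XAlt); rewrite Alt_even -odd_perm_ord pE -Alt_even; exact: subgP.
  by exists x => //; apply: val_inj; rewrite /= fE xE pE.
- move=> x Fx [h Hh] /(congr1 val); rewrite /= !fE => /perm_ord_injective E.
  exact: rhoF Fx Hh (esym E).
Qed.

Lemma separable_symmetric : separable symmetric_groups H.
Proof.
move=> F Ffin FH.
have [X [rho [rhoE rhoF XAlt [i Xodd]]]] := separating_wset false Ffin FH.
pose f x : {perm 'I_#|X|} := perm_ord (rho x).
have fM : {morph f : x y / x * y} by move=> x y; rewrite /f gmulfM perm_ordM.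
pose fB := isMultiplicative.Build W {perm 'I_#|X|} f fM.
pose fm : {multiplicative W -> {perm 'I_#|X|}} := HB.pack f fB.
exists {perm 'I_#|X|}, fm; split.
- exists #|X|; exists idfun; by exists idfun.
- have rho_even p : ~~ odd_perm p -> exists x, rho x = p.
    move=> p_even; apply: (gens_sub_range rhoE); apply: (fintype.subsetP XAlt).
    by rewrite Alt_even.
  apply/seteqP; split=> // q _; have [p <-] := perm_ord_surj q.
  have [x xE] : exists x, rho x = p.
    have [p_odd|p_even] := boolP (odd_perm p); last exact: rho_even.
    have [|x xE] := rho_even (p * wperm X i); first by rewrite odd_permM p_odd Xodd.
    by exists (x * (gen i)^-1); rewrite gmulfM mult_inv xE rhoE mulgK.
  by exists x; rewrite //= /f xE.
- move=> x Fx [h Hh] /perm_ord_injective E.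
  exact: rhoF Fx Hh (esym E).
Qed.

End Separation.

(** * Obstruction when the complement graph is disconnected *)

Section NormalSubgroups.
Local Open Scope group_scope.

(** The generators in [J] span a normal subgroup, centralized by the others. For [n] at least 5
    simplicity makes it trivial or everything; in the latter case [p b] is central and nontrivial,
    so the whole group is abelian. Both cases kill the 12th power. *)
Lemma Alt_normal_obstruction n (A : finType) (p : A -> {perm 'I_n}) (J : pred A) i j b :
  <<[set p k | k in [set: A]]>> = 'Alt_('I_n) ->
  (forall k, p k * p k = 1) ->
  (forall k l, J k -> ~~ J l -> commute (p k) (p l)) ->
  J i -> J j -> ~~ J b -> p b != 1 -> (p i * p j) ^+ 12 != 1 -> False.
Proof.
move=> gensA p2 pC Ji Jj Jb pb1 pij.
have pA k : p k \in 'Alt_('I_n) by rewrite -gensA mem_gen ?imset_f ?inE.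
have [n4|n5] := leqP n 4.
  (* For [n] at most 4 the order of the alternating group divides 12. Being even, 12 also kills the
     involutions in the abelian case below. *)
  case/negP: pij; rewrite -order_dvdn.
  apply: dvdn_trans (_ : #|'Alt_('I_n)| %| 12)%N; first by rewrite order_dvdG ?groupM.
  have [n1|n1] := leqP n 1.
    by rewrite trivial_Alt_2 ?cards1 // card_ord; lia.
  rewrite -(@dvdn_pmul2l 2) // card_Alt card_ord //.
  by case: n {p gensA p2 pC pb1 pA n1} n4 => [|[|[|[|[|]]]]].
have simA : simple 'Alt_('I_n) by apply: simple_Alt5; rewrite card_ord.
have [_ normal_cases] := simpleP _ simA.
pose N := <<[set p k | k in J]>>.
have bN : p b \in 'C(N).
  rewrite /N cent_gen; apply/centP => _ /imsetP[k Jk ->].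
  by apply: commute_sym; apply: pC.
have NA : N <| 'Alt_('I_n).
  apply/andP; split; first by rewrite gen_subG; apply/fintype.subsetP => _ /imsetP[k _ ->].
  rewrite -gensA gen_subG; apply/fintype.subsetP => _ /imsetP[k _ ->].
  have [Jk|Jk] := boolP (J k).
    by apply: (fintype.subsetP (normG [group of N])); rewrite mem_gen ?imset_f.
  apply: (fintype.subsetP (cent_sub N)); rewrite /N cent_gen; apply/centP => _ /imsetP[l Jl ->].
  by apply: commute_sym; apply: pC.
have pN k : J k -> p k \in N by move=> Jk; rewrite mem_gen ?imset_f.
have [N1|NE] := normal_cases _ NA.
  have p1 k : J k -> p k = 1 by move=> /pN; rewrite (N1 : N = 1) => /set1P.
  by rewrite !p1 // mulg1 expg1n eqxx in pij.
have bZ : p b \in 'Z('Alt_('I_n)) by rewrite inE pA -(NE : N = 'Alt_('I_n)).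
have [Z1|ZE] := normal_cases _ (center_normal [group of 'Alt_('I_n)]).
  by rewrite Z1 inE (negPf pb1) in bZ.
have : p i \in 'Z('Alt_('I_n)) by rewrite ZE.
case/centerP => _ /(_ _ (pA j)) ijC.
case/eqP: pij; have p12 k : p k ^+ 12 = 1 by rewrite (expgM _ 2 6) (p2 k : p k ^+ 2 = 1) expg1n.
by rewrite expgMn // !p12 mulg1.
Qed.
End NormalSubgroups.

Section Obstruction.
Variables (I : finType) (e : rel I).
Hypotheses (e_sym : symmetric e) (e_irr : irreflexive e).
Local Open Scope group_scope.
Local Notation gen := (racg_gen e).
Local Notation W := (racg e).

Lemma rev_ordS_inv n : involutive (fun x : 'I_n => rev_ord (ordS x)).
Proof.
move=> x; apply: val_inj => /=; have xn := ltn_ord x.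
have [E|E] := eqVneq x.+1 n.
  rewrite E modnn (_ : (n - 1).+1 = n) ?modnn; lia.
have xn' : x.+1 < n by rewrite ltn_neqAle E.
by rewrite (modn_small xn') modn_small; lia.
Qed.

(** Send [gen i] and [gen j] to two reflections of a cycle of [k.+1] points whose product is the
    one-step rotation, and the other generators to 1; the [k]-th power then moves 0 to [k]. *)
Lemma gen_mul_order i j k : i != j -> ~~ e i j -> 0 < k -> (gen i * gen j) ^+ k <> 1.
Proof.
move=> ij eij k0.
pose s := perm (can_inj (@rev_ordS_inv k.+1)); pose t := perm (can_inj (@rev_ordK k.+1)).
pose phi l := if l == i then s else if l == j then t else 1.
have [||f fE] := @racg_universal I e {perm 'I_k.+1} phi.
- move=> l; rewrite /phi; case: (l == i).
    by apply/permP => x; rewrite permM !permE; exact: rev_ordS_inv.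
  case: (l == j); last by rewrite mulg1.
  by apply/permP => x; rewrite permM !permE rev_ordK.
- move=> l m elm; rewrite /phi.
  have [li|li] := eqVneq l i; have [mi|mi] := eqVneq m i; rewrite ?mulg1 ?mul1g //.
  + have [mj|_] := eqVneq m j; last by rewrite mulg1 mul1g.
    by move: elm; rewrite li mj (negPf eij).
  + have [lj|_] := eqVneq l j; last by rewrite mulg1 mul1g.
    by move: elm; rewrite e_sym lj mi (negPf eij).
  + by case: (l == j); case: (m == j); rewrite ?mulg1 ?mul1g.
move=> E; have := congr1 f E; rewrite mult_one mult_exp gmulfM !fE /phi !eqxx.
rewrite [j == i]eq_sym (negPf ij) => /permP/(_ ord0); rewrite perm1.
have stE x : (s * t) x = ordS x by rewrite permM !permE rev_ordK.
have : forall m, m <= k -> val (((s * t) ^+ m) ord0) = m.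
  elim=> [|m IH] mk; first by rewrite expg0 perm1.
  by rewrite expgSr permM stE /= IH 1?ltnW // modn_small.
by move=> /(_ k (leqnn k)) /[swap] -> /= k00; rewrite -k00 in k0.
Qed.

Local Open Scope classical_set_scope.

Lemma trivial_subgroup : is_subgroup [set (1 : W)].
Proof.
split; first by rewrite inE.
by move=> x y; rewrite !inE => -> ->; rewrite mulgV.
Qed.

Lemma trivial_infinite_index i j : i != j -> ~~ e i j -> infinite_index [set (1 : W)].
Proof.
move=> ij eij fin.
pose F k := ltranslate ((gen i * gen j) ^+ k) [set (1 : W)].
apply: infinite_nat.
have <- : F @^-1` [set ltranslate g [set 1] | g in [set: W]] = [set: nat].
  by apply/seteqP; split=> // k _; exists ((gen i * gen j) ^+ k).
apply: finite_preimage fin => k l _ _.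
wlog kl : k l / k <= l => [wl|].
  by case/orP: (leq_total k l) => [/wl//|/wl wl' E]; apply/esym/wl'.
rewrite /F /ltranslate !image_set1 !mulg1 => E.
have {E} : (gen i * gen j) ^+ k = (gen i * gen j) ^+ l.
  have : [set (gen i * gen j) ^+ l] ((gen i * gen j) ^+ k) by rewrite -E.
  by [].
rewrite -(subnKC kl) expgnDr -{1}[_ ^+ k]mulg1 => /mulgI/esym.
case: (posnP (l - k)) => [->|lk]; first by rewrite addn0.
by move/(gen_mul_order ij eij lk).
Qed.

Lemma trivial_convex_cocompact : convex_cocompact [set (1 : W)].
Proof.
exists [set [set 1]]; split.
- by exists [set 1].
- split; first split.
  + by move=> _ ->; exact: DM_vertex.
  + move=> _ d -> [g [P [_ dE]]] d1 /=; apply/seteqP; split=> // _ ->.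
    have gd : d g by rewrite dE; exists finset.set0; [exact: finset.sub0set | rewrite big_set0 mulg1].
    by have := d1 _ gd => /= <-.
  + move=> u p /= u1 l1 [_ /(_ [::] isT)].
    have uE : u = 1 by have : [set u] u by []; rewrite u1.
    have lE : last u p = 1 by have : [set last u p] (last u p) by []; rewrite l1.
    by rewrite lE /= uE => /(_ erefl); case: p {l1 lE}.
- by move=> h c -> /= ->; rewrite /ltranslate image_set1 mulg1.
- exists [set [set 1]]; split=> // c ->; exists 1, [set 1]; split=> //.
  by rewrite /ltranslate image_set1 mulg1.
Qed.

(** Generators in the complement component of [i] commute with all the others, so no alternating
    quotient keeps both [gen b] and the 12th power of [gen i * gen j] nontrivial. *)
Lemma trivial_not_separable i j b : i != j -> ~~ e i j -> ~~ connect (graph_compl e) i b ->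
  ~ separable alternating_groups [set (1 : W)].
Proof.
move=> ij eij ib sep.
pose J := connect (graph_compl e) i.
have Jadj k l : J k -> ~~ J l -> e k l.
  move=> Jk Jl; have kl : k != l by apply: contraNneq Jl => <-.
  apply: contraNT Jl => ekl; apply: connect_trans Jk (connect1 _).
  by rewrite /graph_compl /= kl.
have Ffin : finite_set [set gen b; (gen i * gen j) ^+ 12] by exact: finite_set2.
have [|Q [f [[n [a [a' aK a'K]]] fsurj fF]]] := sep _ Ffin.
  by move=> x [->|->] /=; [exact: gen_neq1 | exact: gen_mul_order].
pose p k : {perm 'I_n} := sgval (a (f (gen k))).
have pM x y : sgval (a (f (x * y))) = sgval (a (f x)) * sgval (a (f y)).
  by rewrite gmulfM gmulfM.
have p1 : sgval (a (f 1)) = 1 by rewrite !mult_one.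
have f1 x : [set gen b; (gen i * gen j) ^+ 12] x -> sgval (a (f x)) != 1.
  move=> Fx; apply/eqP => afx; apply: (fF x Fx); exists 1 => //.
  by apply: (can_inj aK); apply: val_inj; rewrite /= p1.
apply: (@Alt_normal_obstruction n I p J i j b).
- apply/eqP; rewrite finset.eqEsubset gen_subG; apply/andP; split.
    by apply/fintype.subsetP => _ /imsetP[k _ ->]; exact: subgP.
  apply/fintype.subsetP => q qA.
  have [x _ xE] : range f (a' (subg _ q)) by rewrite fsurj.
  have -> : q = sgval (a (f x)) by rewrite xE a'K subgK.
  have [w <-] := word_prod_surj x; elim: w {xE} => [|k w IH]; first by rewrite p1 group1.
  by rewrite pM groupM //; apply/mem_gen/imsetP; exists k.
- by move=> k; rewrite -pM racg_gen2 p1.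
- by move=> k l Jk Jl; rewrite /commute -!pM racg_genC // Jadj.
- exact: connect0.
- by apply: connect1; rewrite /graph_compl /= ij.
- exact: ib.
- by apply: f1; left.
- have := f1 _ (or_intror erefl).
  have pX x m : sgval (a (f (x ^+ m))) = sgval (a (f x)) ^+ m.
    by elim: m => [|m IH]; rewrite ?p1 // !expgS pM IH.
  by rewrite pX pM.
Qed.

End Obstruction.

Theorem theoremA (I : finType) (e : rel I)
  (e_simple : simple_graph e)
  (e_nondiscrete : ~ discrete_graph e)
  (I_ge3 : (3 <= #|I|)%N)
  (e_noncomplete : ~ complete_graph e) :
  (forall H : set (racg e),
      is_subgroup H -> infinite_index H -> convex_cocompact H ->
      separable alternating_groups H /\ separable symmetric_groups H)
  <-> connected_graph (graph_compl e).
Proof.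
have [e_sym e_irr] := e_simple; split=> [sep|[_ conn] H Hgrp Hinf Hcc]; last first.
  by split; [exact: separable_alternating | exact: separable_symmetric].
split; first exact: ltn_trans I_ge3.
move=> x y; apply: contrapT => /negP xy.
have [i [j [ij eij]]] : exists i j, i != j /\ ~~ e i j.
  apply: contrapT => nij; apply: e_noncomplete => i j ij.
  by apply: contrapT => /negP eij; apply: nij; exists i, j.
have compl_sym : connect_sym (graph_compl e).
  by apply: sym_connect_sym => k l; rewrite /graph_compl /= eq_sym e_sym.
(* Since [x] and [y] lie in different components, one of them is outside the component of [i]. *)
have [b ib] : exists b, ~~ connect (graph_compl e) i b.
  have [ix|ix] := boolP (connect (graph_compl e) i x); last by exists x.
  exists y; apply: contraNN xy; apply: connect_trans.
  by rewrite compl_sym.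
apply: (trivial_not_separable e_sym ij eij ib).
by case: (sep _ (trivial_subgroup e) (trivial_infinite_index e_sym ij eij)
  (trivial_convex_cocompact e)).
Qed.
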